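(* Let $n \geq 2$ and let $p$ be a prime number. Let \[ V_n(\mathbb{Z}_p)_{p \nmid a_n} = \{f(x) = x^n + a_1 x^{n - 1} + \ldots + a_n \in \mathbb{Z}_p[x] : p \nmid a_n\}. \] Then \begin{align*} P^{\mathrm{sqf}}(V_n(\mathbb{Z}_p)_{p \nmid a_n}) &= \begin{cases} \dfrac{2}{3} \left(1 - \dfrac{(-1)^n}{2^n}\right) & \text{if } p = 2, \\ 1 - \dfrac{3p - 1}{p(p + 1)^2} + O\left(\dfrac{n}{p^{n - 1}}\right) & \text{if } p \neq 2, \end{cases} \\ P^{\max}(V_n(\mathbb{Z}_p)_{p \nmid a_n}) &= 1 - \frac{1}{p^2 + p + 1} + O\left(\frac{1}{p^{n + \lceil n/2 \rceil}}\right), \end{align*} where the implied constants are absolute, and these densities are positive.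
   Context: $V_n(\mathbb{Z}_p)$ denotes the set of monic polynomials of degree $n$ over $\mathbb{Z}_p$, identified with $\mathbb{Z}_p^n$ via the coefficients, with Haar measure. For a subset $\Sigma$ of positive measure, $P^{\mathrm{sqf}}(\Sigma)$ denotes the density (measure of the subset divided by measure of $\Sigma$) of $f \in \Sigma$ whose discriminant is not divisible by $p^2$, and $P^{\max}(\Sigma)$ denotes the density of $f \in \Sigma$ such that $\mathbb{Z}_p[x]/(f(x))$ is the maximal order of $\mathbb{Q}_p[x]/(f(x))$. *)

(* Defs.v *)
From HB Require Import structures.
From mathcomp Require Import all_boot all_order all_algebra.
From mathcomp Require Import qpoly.
From mathcomp Require Import all_classical all_reals all_analysis.

Set Implicit Arguments.
Unset Strict Implicit.
Unset Printing Implicit Defensive.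

Import Order.TTheory GRing.Theory Num.Theory.

Local Open Scope classical_set_scope.
Local Open Scope ring_scope.

(* The ring Z_p as the inverse limit of the Z/p^k: [padic_res x k] is the     *)
(* representative in [0, p^k) of x mod p^k. The compatibility condition alone *)
(* forces [padic_res x k < p^k]. Primality is carried by the type so that Z_p *)
(* can be declared an integral domain.                                        *)
Record padic_int (p : nat) (p_pr : prime p) := PadicInt {
  padic_res : nat -> nat;
  padic_resP : forall k, padic_res k = (padic_res k.+1 %% p ^ k)%N
}.

Section PadicInt.
Variables (p : nat) (p_pr : prime p).
Local Notation Zp := (padic_int p_pr).
Implicit Types x y z : Zp.

HB.instance Definition _ := gen_eqMixin Zp.
HB.instance Definition _ := gen_choiceMixin Zp.

Lemma padic_eq x y : padic_res x =1 padic_res y -> x = y.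
Proof.
case: x y => [x xP] [y yP] /= /funext exy; case: y / exy yP => yP.
by congr PadicInt; exact: Prop_irrelevance.
Qed.

Lemma padic_res_mod x k m : (k <= m)%N ->
  (padic_res x m %% p ^ k)%N = padic_res x k.
Proof.
elim: m => [|m IHm].
  by rewrite leqn0 => /eqP->; rewrite expn0 modn1 padic_resP expn0 modn1.
rewrite leq_eqVlt => /predU1P[->|].
  by rewrite padic_resP modn_dvdm // dvdn_exp2l.
rewrite ltnS => le_km; rewrite -(IHm le_km) [in RHS]padic_resP.
by rewrite modn_dvdm // dvdn_exp2l.
Qed.

Lemma padic_res_lt x k : (padic_res x k < p ^ k)%N.
Proof. by rewrite padic_resP ltn_mod expn_gt0 prime_gt0. Qed.

Lemma padic_res_small x k : (padic_res x k %% p ^ k)%N = padic_res x k.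
Proof. exact: padic_res_mod. Qed.

Lemma padic_nat_subproof (m k : nat) :
  (m %% p ^ k)%N = ((m %% p ^ k.+1) %% p ^ k)%N.
Proof. by rewrite modn_dvdm // dvdn_exp2l. Qed.

Definition padic_nat (m : nat) : Zp := PadicInt p_pr (padic_nat_subproof m).

Lemma padic_add_subproof x y k :
  ((padic_res x k + padic_res y k) %% p ^ k)%N =
  (((padic_res x k.+1 + padic_res y k.+1) %% p ^ k.+1) %% p ^ k)%N.
Proof.
by rewrite -padic_nat_subproof -[in RHS]modnDm -!padic_resP.
Qed.

Definition padic_add x y : Zp := PadicInt p_pr (padic_add_subproof x y).

Lemma padic_mul_subproof x y k :
  ((padic_res x k * padic_res y k) %% p ^ k)%N =
  (((padic_res x k.+1 * padic_res y k.+1) %% p ^ k.+1) %% p ^ k)%N.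
Proof.
by rewrite -padic_nat_subproof -[in RHS]modnMm -!padic_resP.
Qed.

Definition padic_mul x y : Zp := PadicInt p_pr (padic_mul_subproof x y).

Lemma padic_opp_subproof x k :
  ((p ^ k - padic_res x k) %% p ^ k)%N =
  (((p ^ k.+1 - padic_res x k.+1) %% p ^ k.+1) %% p ^ k)%N.
Proof.
rewrite -padic_nat_subproof; apply/eqP.
rewrite -(eqn_modDr (padic_res x k)) subnK; last exact/ltnW/padic_res_lt.
rewrite [X in _ == (_ + X) %[mod _]]padic_resP modnDmr subnK; last first.
  exact/ltnW/padic_res_lt.
by rewrite expnS modnMl modnn.
Qed.

Definition padic_opp x : Zp := PadicInt p_pr (padic_opp_subproof x).

Lemma padic_addA : associative padic_add.
Proof. by move=> x y z; apply: padic_eq => k /=; rewrite modnDmr modnDml addnA. Qed.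

Lemma padic_addC : commutative padic_add.
Proof. by move=> x y; apply: padic_eq => k /=; rewrite addnC. Qed.

Lemma padic_add0 : left_id (padic_nat 0) padic_add.
Proof.
by move=> x; apply: padic_eq => k /=; rewrite mod0n add0n padic_res_small.
Qed.

Lemma padic_addN : left_inverse (padic_nat 0) padic_opp padic_add.
Proof.
move=> x; apply: padic_eq => k /=.
by rewrite modnDml subnK ?modnn ?mod0n //; exact/ltnW/padic_res_lt.
Qed.

HB.instance Definition _ :=
  GRing.isZmodule.Build Zp padic_addA padic_addC padic_add0 padic_addN.

Lemma padic_mulA : associative padic_mul.
Proof. by move=> x y z; apply: padic_eq => k /=; rewrite modnMmr modnMml mulnA. Qed.

Lemma padic_mulC : commutative padic_mul.
Proof. by move=> x y; apply: padic_eq => k /=; rewrite mulnC. Qed.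

Lemma padic_mul1 : left_id (padic_nat 1) padic_mul.
Proof.
by move=> x; apply: padic_eq => k /=; rewrite modnMml mul1n padic_res_small.
Qed.

Lemma padic_mulDl : left_distributive padic_mul padic_add.
Proof.
by move=> x y z; apply: padic_eq => k /=; rewrite modnMml modnDm mulnDl.
Qed.

Lemma padic_oner_neq0 : padic_nat 1 != 0.
Proof.
apply/eqP => /(congr1 (fun x => padic_res x 1)) /=.
by rewrite mod0n modn_small // expn1 prime_gt1.
Qed.

HB.instance Definition _ := GRing.Zmodule_isComNzRing.Build Zp
  padic_mulA padic_mulC padic_mul1 padic_mulDl padic_oner_neq0.

Definition padic_unit : {pred Zp} := [pred x | `[< exists y, y * x = 1 >]].

Definition padic_inv x : Zp :=
  if pselect (exists y, y * x = 1) is left e then projT1 (cid e) else x.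

Lemma padic_mulVx : {in padic_unit, left_inverse 1 padic_inv *%R}.
Proof.
move=> x /asboolP ux; rewrite /padic_inv.
by case: pselect => // e; case: cid.
Qed.

Lemma padic_unitPl x y : y * x = 1 -> padic_unit x.
Proof. by move=> yx1; apply/asboolP; exists y. Qed.

Lemma padic_inv_out : {in [predC padic_unit], padic_inv =1 id}.
Proof.
move=> x /negP nux; rewrite /padic_inv; case: pselect => // e.
by case: nux; apply/asboolP.
Qed.

HB.instance Definition _ := GRing.ComNzRing_hasMulInverse.Build Zp
  padic_mulVx padic_unitPl padic_inv_out.

Lemma padic_neq0 x : x != 0 -> exists k, padic_res x k != 0%N.
Proof.
move=> x_neq0; apply: contrapT => x0; move/eqP: x_neq0; apply.
apply: padic_eq => k /=; rewrite mod0n; apply/eqP.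
by apply: contra_notT x0 => xk; exists k.
Qed.

Lemma padic_integral x y : x * y = 0 -> (x == 0) || (y == 0).
Proof.
move=> xy0; apply: contraPT xy0; rewrite negb_or.
move=> /andP[/padic_neq0[i xi] /padic_neq0[j yj]].
move/(congr1 (fun z => padic_res z (i + j))) => /=.
move/eqP; rewrite mod0n -/(dvdn _ _); apply/negP.
have val_lt z a : padic_res z a != 0%N ->
    (a <= i + j)%N -> (0 < padic_res z (i + j))%N &&
    (logn p (padic_res z (i + j)) < a)%N.
  move=> za le_a; have := za; rewrite -(padic_res_mod z le_a) => nd.
  have z_gt0 : (0 < padic_res z (i + j))%N.
    by case: posnP nd => // ->; rewrite mod0n.
  by rewrite z_gt0 /= ltnNge -pfactor_dvdn.
have /andP[x_gt0 xl] := val_lt x i xi (leq_addr _ _).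
have /andP[y_gt0 yl] := val_lt y j yj (leq_addl _ _).
rewrite pfactor_dvdn ?muln_gt0 ?x_gt0 // lognM // -ltnNge.
by rewrite -addnS leq_add // ltnW.
Qed.

HB.instance Definition _ :=
  GRing.ComUnitRing_isIntegral.Build Zp padic_integral.

(* The p-adic topology: the classes modulo p^k are the basic neighbourhoods.  *)
Definition padic_open : set_system Zp := [set A | forall x, A x ->
  exists k, forall y, padic_res y k = padic_res x k -> A y].

Lemma padic_openT : padic_open setT.
Proof. by move=> x _; exists 0%N. Qed.

Lemma padic_openI : setI_closed padic_open.
Proof.
move=> A B oA oB x [/oA[i Ai] /oB[j Bj]]; exists (maxn i j) => y exy.
split; [apply: Ai | apply: Bj].
  by rewrite -!(padic_res_mod _ (leq_maxl i j)) exy.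
by rewrite -!(padic_res_mod _ (leq_maxr i j)) exy.
Qed.

Lemma padic_open_bigU (I : Type) (F : I -> set Zp) :
  (forall i, padic_open (F i)) -> padic_open (\bigcup_i F i).
Proof.
by move=> oF x [i _ /oF[k Fk]]; exists k => y /Fk Fy; exists i.
Qed.

HB.instance Definition _ := isPointed.Build Zp 0.
HB.instance Definition _ :=
  isOpenTopological.Build Zp padic_openT padic_openI padic_open_bigU.

End PadicInt.

(* An order in an algebra K over the fraction field of a domain Z: a subring  *)
(* that is a finitely generated Z-module and spans K over the fraction field. *)
Definition is_order (Z : idomainType) (K : algType {fraction Z})
    (O : set K) : Prop :=
  [/\ O 1,
      forall x y, O x -> O y -> O (x - y) /\ O (x * y),
      exists (m : nat) (b : 'I_m -> K),
        O = [set \sum_(i < m) tofrac (c i) *: b i | c in [set: 'I_m -> Z]] &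
      forall x : K, exists (m : nat) (b : 'I_m -> K) (c : 'I_m -> {fraction Z}),
        (forall i, O (b i)) /\ x = \sum_(i < m) c i *: b i].

Definition is_maximal_order (Z : idomainType) (K : algType {fraction Z})
    (O : set K) : Prop :=
  is_order O /\ forall O' : set K, is_order O' -> O `<=` O' -> O' = O.

Section Polynomials.
Variable Z : idomainType.
Implicit Types f : {poly Z}.

(* For f monic of degree n with f' of degree n - 1, as is the case over Z_p   *)
(* when n >= 1: Disc f = (-1)^(n(n-1)/2) Res(f, f').                          *)
Definition poly_disc f : Z :=
  (-1) ^+ 'C((size f).-1, 2) * resultant f f^`().

(* The image of Z[x]/(f) in {poly %/ map_poly tofrac f} = Frac(Z)[x]/(f), for *)
(* f monic of positive degree.                                                *)
Definition monogenic_order f : set {poly %/ map_poly (@tofrac Z) f} :=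
  [set in_qpoly (map_poly (@tofrac Z) f) (map_poly (@tofrac Z) g)
     | g in [set: {poly Z}]].

(* a_(i+1) is [a 0 i] *)
Definition monic_of_row (n : nat) (a : 'rV[Z]_n) : {poly Z} :=
  'X^n + \sum_(i < n) a 0 i *: 'X^(n - i.+1).

End Polynomials.

Notation borelType T := (g_sigma_algebraType (@open T)).

Section Densities.
Variables (R : realType) (p : nat) (p_pr : prime p) (n : nat).
Local Notation Zp := (padic_int p_pr).
Local Notation V := 'rV[Zp]_n.
Implicit Types (mu : probability (borelType V) R) (S : set V).

(* Haar measure on the compact group Z_p^n, normalised to total mass 1        *)
Definition is_haar mu : Prop :=
  forall (a : V) (A : set (borelType V)), measurable A ->
    mu ((fun x : V => a + x) @` A) = mu A.

Definition density mu S (P : set V) : R := fine (mu (S `&` P)) / fine (mu S).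

Definition zp_dvd (d x : Zp) : Prop := exists c, x = c * d.

Definition P_sqf mu S : R :=
  density mu S
    [set a | ~ zp_dvd (p%:R ^+ 2) (poly_disc (monic_of_row a))].

Definition P_max mu S : R :=
  density mu S [set a | is_maximal_order (@monogenic_order Zp (monic_of_row a))].

(* The constant coefficient of [monic_of_row a] is a_n when n > 0.            *)
Definition V_unit_const : set V :=
  [set a | ~ zp_dvd p%:R (monic_of_row a)`_0].

End Densities.

Arguments V_unit_const {p} p_pr n.

(* Main.v *)
(* Both events depend only on f modulo p^2, so their probabilities are
   proportions of pairs (f mod p, second digit of f).
   By Dedekind's criterion, Z_p[x]/(f) fails to be maximal iff f lies in the
   square of the ideal (p, d) for some monic d <> 1 over F_p: an element
   (D A + p B)/p built from f = D^2 A + p D B + p^2 C enlarges the order, and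
   conversely an integral element outside the order produces such a d. The d
   with f in (p, d)^2 are the divisors of a single one, so the proportion is a
   Moebius sum over d with 2 deg d <= n, which is a geometric series.
   For p odd, v_p(disc f) <= 1 iff f mod p is squarefree, or f mod p is
   (x - a)^2 g with g squarefree, g(a) <> 0, and p^2 does not divide f(a) for a
   fixed lift of a; for p = 2 only the first case occurs. The numbers s_n of
   squarefree f mod p with f(0) <> 0 come from the same Moebius sum, and the
   numbers u_n of those that also avoid the root a satisfy u_n + u_(n-1) = s_n,
   whose characteristic root -1, doubled by that of s_n, causes the error term
   n / p^(n-1). *)

Require Import Defs.
From HB Require Import structures.
From mathcomp Require Import all_boot all_order all_algebra all_field.
From mathcomp Require Import qpoly generic_quotient.
From mathcomp Require Import all_classical all_reals all_analysis.
From mathcomp Require Import ring lra zify.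

Set Implicit Arguments.
Unset Strict Implicit.
Unset Printing Implicit Defensive.

Import Order.TTheory GRing.Theory Num.Theory.

Local Open Scope classical_set_scope.
Local Open Scope ring_scope.

(** * Counting monic polynomials over a finite field *)

(** The algebra is done over any domain [Z] with a nonzero [pi], a morphism [red] to a field whose
    kernel is generated by [pi], and a section [L] of [red]; Z_p enters only later. As [L] need not
    be additive, a polynomial is compared with a lift by writing the difference as a multiple of
    [pi], never by tracking carries. The counting avoids unique factorisation: of the Moebius
    function only the sums over each degree are needed, and these are the coefficients of an inverse
    power series. The condition f(0) <> 0 passes to divisors, so it does not disturb the Moebius
    sums; it only makes degree zero exceptional, which shapes the error term for even n.
    Divisibility of a resultant by [pi ^+ 2] is read off the left kernel of the Sylvester matrix
    modulo [pi]: dimension at least two gives it, dimension zero excludes it, and dimension one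
    needs a look modulo [pi ^+ 2]. Translation invariance of the measure is used only for the
    finitely many cosets of p^2 Z_p^n, which are open. *)

Lemma monic_eqp (F : fieldType) (f g : {poly F}) : f \is monic -> g \is monic -> f %= g -> f = g.
Proof. by move=> fm gm; rewrite eqp_monic // => /eqP. Qed.

Section Monics.
Variable F : finFieldType.
Implicit Types d e f g : {poly F}.

Definition monics n : seq {poly F} := [seq 'X^n + rVpoly a | a : 'rV[F]_n].

Lemma mem_monics n f : (f \in monics n) = (f \is monic) && (size f == n.+1).
Proof.
apply/fintype.imageP/andP => [[a _ ->]|[/monicP f_mon /eqP f_sz]].
  have sz_a : (size (rVpoly a) < size ('X^n : {poly F}))%N.
    by rewrite size_polyXn ltnS size_poly.
  by rewrite monicE lead_coefDl // lead_coefXn size_polyDl // size_polyXn !eqxx.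
exists (poly_rV f) => //; apply/polyP => i.
rewrite coefD coefXn coef_rVpoly; case: insubP => [j _ <-|].
  by rewrite mxE (ltn_eqF (ltn_ord j)) add0r.
rewrite -leqNgt leq_eqVlt => /predU1P[<-|lt_ni].
  by rewrite eqxx addr0 -f_mon lead_coefE f_sz.
by rewrite gtn_eqF // nth_default ?addr0 // f_sz.
Qed.

Lemma monics_uniq n : uniq (monics n).
Proof.
rewrite map_inj_uniq ?enum_uniq // => a b /addrI; exact: (can_inj rVpolyK).
Qed.

Lemma size_monics n : size (monics n) = (#|F| ^ n)%N.
Proof. by rewrite size_image card_mx mul1n. Qed.

Lemma monics0 : monics 0 = [:: 1].
Proof.
apply: perm_small_eq => //; apply: uniq_perm; rewrite ?monics_uniq // => f.
rewrite mem_monics inE; apply/andP/eqP => [[/monicP f_mon /eqP/eq_leq f_sz]|->].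
  have f1 := size1_polyC f_sz.
  by rewrite f1; congr _%:P; rewrite -f_mon lead_coefE f1 size_polyC; case: eqP.
by rewrite monic1 size_poly1.
Qed.

Lemma monics_monic n f : f \in monics n -> f \is monic.
Proof. by rewrite mem_monics => /andP[]. Qed.

Lemma monics_size n f : f \in monics n -> size f = n.+1.
Proof. by rewrite mem_monics => /andP[_ /eqP]. Qed.

Lemma monic_monics f : f \is monic -> f \in monics (size f).-1.
Proof.
by move=> f_mon; rewrite mem_monics f_mon /= prednK ?size_poly_gt0 ?monic_neq0.
Qed.

Lemma monic_dvd_quo d f : d \is monic -> f \is monic -> d %| f ->
  exists2 g, g \is monic & f = d * g.
Proof.
move=> dm fm /divpK; rewrite mulrC => fE; exists (f %/ d) => //.
by move: fm; rewrite -{1}fE monicMl.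
Qed.

Section Sums.
Variable R : comNzRingType.

(** Multiplication by d is a bijection from the monic polynomials of degree n - k to the multiples
    of d of degree n. Divisibility constraints in the counts below are removed this way. *)
Lemma big_monics_dvd k n d (G : {poly F} -> R) (P : pred {poly F}) :
  d \in monics k ->
  \sum_(f <- monics n | P f && (d %| f)) G f =
  if (k <= n)%N then \sum_(g <- monics (n - k) | P (d * g)) G (d * g) else 0.
Proof.
move=> dk; have dm := monics_monic dk; have ds := monics_size dk.
case: leqP => [le_kn|lt_nk]; last first.
  apply: big1_seq => f /andP[/andP[_ df] fn].
  have := dvdp_leq (monic_neq0 (monics_monic fn)) df.
  by rewrite ds (monics_size fn) ltnS leqNgt lt_nk.
have inj : injective ( *%R d) by apply/mulfI/monic_neq0.
rewrite -[RHS](big_map ( *%R d) P G).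
rewrite -[LHS]big_filter -[RHS]big_filter.
apply: perm_big; apply: uniq_perm.
- exact/filter_uniq/monics_uniq.
- by apply: filter_uniq; rewrite map_inj_uniq // monics_uniq.
move=> f; rewrite !mem_filter; apply/andP/andP => [[/andP[Pf df] fn]|].
  have [g gm fE] := monic_dvd_quo dm (monics_monic fn) df.
  split=> //; apply/mapP; exists g => //.
  rewrite mem_monics gm /= -(eqn_add2l k.+1) -ds.
  have := monics_size fn; rewrite fE size_monicM ?monic_neq0 // ds => /=.
  by move=> sE; apply/eqP; lia.
move=> [Pf /mapP[g gn fE]]; split; first by rewrite Pf fE dvdp_mulr.
rewrite fE mem_monics monicMl // (monics_monic gn) size_monicM ?(monic_neq0 (monics_monic gn)) //=.
by rewrite ds (monics_size gn) addSn addnS subnKC.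
Qed.

Lemma sum_monics n : \sum_(f <- monics n) 1 = #|F|%:R ^+ n :> R.
Proof. by rewrite big_const_seq count_predT size_monics iter_addr_0 natrX. Qed.

Definition count_nz n : R := \sum_(f <- monics n | ~~ root f 0) 1.

Lemma count_nz0 : count_nz 0 = 1.
Proof. by rewrite /count_nz monics0 big_cons big_nil rootC oner_eq0 addr0. Qed.

Lemma XsubC_monics (a : F) : 'X - a%:P \in monics 1.
Proof. by rewrite mem_monics monicXsubC size_XsubC. Qed.

(** The subtracted term counts the multiples of X. Degree 0 stays exceptional: its count is 1 and
    not 1 - 1/q, the source of the boundary term in the maximality density for even n. *)
Lemma count_nzS n : count_nz n.+1 = #|F|%:R ^+ n.+1 - #|F|%:R ^+ n.
Proof.
rewrite -!sum_monics [in RHS](bigID (fun f => root f 0)) /=.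
under eq_bigl => f do rewrite -dvdp_XsubCl.
have := @big_monics_dvd 1 n.+1 ('X - 0%:P) (fun=> 1) xpredT (XsubC_monics 0).
by rewrite /= subSS subn0 => ->; rewrite addrC addrK.
Qed.

(* The Moebius function of polynomials of degree at most n, by recursion on the
   relation that its sum over the monic divisors of f vanishes unless f = 1. *)
Fixpoint mobius_rec n f : R :=
  if n is m.+1 then
    if (size f <= m.+1)%N then mobius_rec m f
    else - \sum_(k < m.+1) \sum_(d <- monics k | d %| f) mobius_rec m d
  else 1.

Definition mobius f := mobius_rec (size f).-1 f.

Lemma mobius_recE n f : (size f <= n.+1)%N -> mobius_rec n f = mobius f.
Proof.
elim: n => [|n IHn] /= sf; first by rewrite /mobius; case: (size f) sf => [|[]].
case: ifP => [/IHn//|nsf]; rewrite /mobius.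
have -> : size f = n.+2 by apply/eqP; rewrite eqn_leq sf ltnNge nsf.
by rewrite /= nsf.
Qed.

Lemma sum_mobius_dvd n f : f \in monics n ->
  \sum_(k < n.+1) \sum_(d <- monics k | d %| f) mobius d = (n == 0)%:R.
Proof.
case: n => [|n] fn.
  rewrite big_ord1 monics0 big_cons big_nil.
  by move: fn; rewrite monics0 inE => /eqP->; rewrite dvdpp addr0 /mobius size_poly1.
rewrite big_ord_recr /= -(@big_filter _ _ _ _ _ (fun d => d %| f)).
have -> : [seq d <- monics n.+1 | d %| f] = [:: f].
  apply: perm_small_eq => //; apply: uniq_perm; rewrite ?filter_uniq ?monics_uniq //.
  move=> d; rewrite mem_filter inE; apply/andP/eqP => [[df dn]|->]; last by rewrite dvdpp.
  apply: monic_eqp; rewrite ?(monics_monic dn) ?(monics_monic fn) //.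
  by rewrite -dvdp_size_eqp // (monics_size dn) (monics_size fn).
rewrite big_seq1 [mobius f]/mobius (monics_size fn) /= (monics_size fn) ltnn.
apply/eqP; rewrite subr_eq0; apply/eqP; apply: eq_bigr => k _.
rewrite big_seq_cond [RHS]big_seq_cond; apply: eq_bigr => d /andP[dk _].
by rewrite mobius_recE // (monics_size dk).
Qed.

(* The monic polynomials satisfying P are the divisors of one of them. *)
Lemma sum_mobius_ideal (P : pred {poly F}) (b : bool) n :
  P 1 ->
  (forall d e, d \is monic -> e \is monic -> d %| e -> P e -> P d) ->
  (forall d e, d \is monic -> e \is monic -> P d -> P e ->
     exists l, [/\ l \is monic, P l, d %| l & e %| l]) ->
  (forall d, d \is monic -> P d -> (size d <= n.+1)%N) ->
  reflect (forall d, d \is monic -> P d -> d = 1) b ->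
  \sum_(k < n.+1) \sum_(d <- monics k | P d) mobius d = b%:R.
Proof.
move=> P1 Pdvd Plcm Pn bP.
have [m [m_mon Pm m_max]] : exists m, [/\ m \is monic, P m &
    forall d, d \is monic -> P d -> d %| m].
  have exk : exists k, [exists a : 'rV[F]_k, P ('X^k + rVpoly a)].
    by exists 0%N; apply/existsP; exists 0; rewrite linear0 addr0 expr0.
  have kn k : [exists a : 'rV[F]_k, P ('X^k + rVpoly a)] -> (k <= n)%N.
    case/existsP => a /Pn; have : 'X^k + rVpoly a \in monics k by apply: fintype.image_f.
    by move=> ak; rewrite (monics_monic ak) (monics_size ak) ltnS; apply.
  case: (ex_maxnP exk kn) => k /existsP[a Pa] k_max.
  have : 'X^k + rVpoly a \in monics k by apply: fintype.image_f.
  set m := 'X^k + _ in Pa * => mk.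
  exists m; split=> //; first exact: monics_monic mk.
  (* The common multiple l of d and m satisfies P, so its degree is at most that of m by the choice
     of m; hence l is an associate of m and d divides m. *)
  move=> d dm Pd; have [l [lm Pl dl ml]] := Plcm _ _ dm (monics_monic mk) Pd Pa.
  have /fintype.imageP[c _ lE] := monic_monics lm.
  have /k_max : [exists a : 'rV[F]_(size l).-1, P ('X^((size l).-1) + rVpoly a)].
      by apply/existsP; exists c; rewrite -lE.
  rewrite -ltnS prednK ?size_poly_gt0 ?monic_neq0 // -(monics_size mk) => le_lm.
  have /eqP : size m == size l.
    by rewrite eqn_leq le_lm dvdp_leq // monic_neq0.
  by move/eqP; rewrite dvdp_size_eqp // => /eqp_dvdr->.
have PE d : d \is monic -> P d = (d %| m).
  by move=> dm; apply/idP/idP => [/m_max->//|dvm]; apply: Pdvd dvm Pm.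
have bE : b = ((size m).-1 == 0)%N.
  apply/bP/eqP => [/(_ m m_mon Pm)->|sm d dm Pd]; first by rewrite size_poly1.
  have := monic_monics m_mon; rewrite sm monics0 inE => /eqP m1.
  by apply: monic_eqp; rewrite ?monic1 // -m1 /eqp m_max //= m1 dvd1p.
rewrite bE -(sum_mobius_dvd (monic_monics m_mon)).
have sm_le : ((size m).-1.+1 <= n.+1)%N.
  by rewrite prednK ?size_poly_gt0 ?monic_neq0 // Pn.
rewrite [RHS](big_ord_widen n.+1 (fun k => \sum_(d <- monics k | d %| m) mobius d) sm_le).
rewrite [LHS](bigID (fun k : 'I_n.+1 => (k < (size m).-1.+1)%N)) /=.
rewrite [X in _ + X]big1 ?addr0 => [|k].
  apply: eq_bigr => k _; rewrite big_seq_cond [RHS]big_seq_cond; apply: eq_bigl => d.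
  by case dk : (d \in _) => //=; rewrite PE // (monics_monic dk).
rewrite -leqNgt => lt_mk; apply: big1_seq => d /andP[Pd dk].
have := dvdp_leq (monic_neq0 m_mon) (m_max _ (monics_monic dk) Pd).
by rewrite (monics_size dk) => /leq_trans/(_ (leqSpred _)); rewrite ltnS leqNgt lt_mk.
Qed.

Definition mobius_nz k : R := \sum_(d <- monics k | ~~ root d 0) mobius d.

(** The generating series of [mobius_nz] and [count_nz] over the degree are inverse to each other:
    for f = d g the condition f(0) <> 0 splits into d(0) <> 0 and g(0) <> 0. *)
Lemma sum_mobius_nz n :
  \sum_(k < n.+1) mobius_nz k * count_nz (n - k) = (n == 0)%:R.
Proof.
have -> : (n == 0)%:R = \sum_(f <- monics n | ~~ root f 0)
    \sum_(k < n.+1) \sum_(d <- monics k | d %| f) mobius d.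
  rewrite big_seq_cond (eq_bigr (fun=> (n == 0)%:R)) => [|f /andP[/sum_mobius_dvd//]].
  rewrite -big_seq_cond; case: n => [|n]; last by rewrite big1.
  by rewrite monics0 big_cons big_nil rootC oner_eq0 addr0.
rewrite exchange_big /=; apply: eq_bigr => k _.
rewrite (exchange_big_dep xpredT) //= mulr_suml [LHS]big_mkcond /=.
apply: eq_big_seq => d dk; rewrite (big_monics_dvd _ _ _ dk).
rewrite -ltnS ltn_ord; under eq_bigl => g do rewrite rootM negb_or.
case: ifP => d0 /=; last by rewrite big_pred0.
by rewrite mulr_sumr; apply: eq_bigr => g _; rewrite mulr1.
Qed.

Lemma mobius_nz0 : mobius_nz 0 = 1.
Proof.
have := sum_mobius_nz 0; rewrite big_ord1 count_nz0 mulr1 //.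
Qed.

(** The inverse of the series (1 - T) / (1 - q T) of [count_nz] is (1 - q T) / (1 - T). The proof
    compares the convolution identity in one degree with q times the previous one, as [count_nz]
    grows by the factor q from degree 1 on. *)
Lemma mobius_nzS k : mobius_nz k.+1 = 1 - #|F|%:R.
Proof.
elim/ltn_ind: k => k IHk.
have S2 := sum_mobius_nz k.+1; rewrite big_ord_recr /= subnn count_nz0 mulr1 in S2.
case: k => [|k] in IHk S2 *.
  move: S2; rewrite big_ord1 mobius_nz0 count_nzS expr1 expr0 mul1r => /eqP.
  by rewrite addrC addr_eq0 => /eqP->; rewrite opprB.
have S1 := sum_mobius_nz k.+1; rewrite big_ord_recr /= subnn count_nz0 mulr1 in S1.
have step : \sum_(i < k.+1) mobius_nz i * count_nz (k.+2 - i) =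
    #|F|%:R * \sum_(i < k.+1) mobius_nz i * count_nz (k.+1 - i).
  rewrite mulr_sumr; apply: eq_bigr => i _; have le_ik : (i <= k)%N := ltn_ord i.
  rewrite !subSn ?leqW //.
  by rewrite !count_nzS !exprS; ring.
rewrite big_ord_recr /= subSnn step in S2; move: S1 S2.
rewrite IHk // count_nzS expr1 expr0; set s := \sum_(i < _) _ => S1 S2.
have sE : s = - (1 - #|F|%:R) by apply/eqP; rewrite -addr_eq0 S1.
rewrite sE in S2; apply/eqP; rewrite -subr_eq0; apply/eqP.
by rewrite -[RHS]S2; ring.
Qed.

(** The weight w allows two uses: w = 1 counts squarefree polynomials, w k = q ^ (n - k) counts
    pairs of digits outside the squares of the ideals (pi, d). *)
Lemma sum_mobius_sqr n K (w : nat -> R) :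
  \sum_(f <- monics n | ~~ root f 0) \sum_(k < K)
    \sum_(d <- monics k | d ^+ 2 %| f) mobius d * w k =
  \sum_(k < K) if (k.*2 <= n)%N then mobius_nz k * w k * count_nz (n - k.*2) else 0.
Proof.
rewrite exchange_big /=; apply: eq_bigr => k _.
rewrite (exchange_big_dep xpredT) //=.
transitivity (\sum_(d <- monics k) if ~~ root d 0 then
    if (k.*2 <= n)%N then mobius d * w k * count_nz (n - k.*2) else 0 else 0).
  apply: eq_big_seq => d dk; have d2k : d ^+ 2 \in monics k.*2.
    rewrite mem_monics monic_exp ?(monics_monic dk) //= expr2.
    by rewrite size_monicM ?(monic_neq0, monics_monic dk) // (monics_size dk); lia.
  rewrite (big_monics_dvd _ _ _ d2k); case: ifP => _; last by rewrite if_same.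
  under eq_bigl => g do rewrite expr2 !rootM !negb_or andbb.
  case: ifP => d0 /=; last by rewrite big_pred0.
  by rewrite mulr_sumr; apply: eq_bigr => g _; rewrite mulr1.
rewrite -big_mkcond; case: ifP => _; last by rewrite big1.
by rewrite -!mulr_suml.
Qed.

End Sums.
End Monics.

(** * Least common multiples and squarefree polynomials *)

Lemma dvdp_sqr (F : fieldType) (d e : {poly F}) : d %| e -> d ^+ 2 %| e ^+ 2.
Proof. by move=> de; rewrite !expr2 dvdp_mul. Qed.

(** After division by the gcd the two polynomials are coprime, and so are their squares; hence the
    square of the lcm is the lcm of the squares. *)
Lemma monic_lcm (F : fieldType) (d e : {poly F}) : d \is monic -> e \is monic ->
  exists l, [/\ l \is monic, d %| l, e %| l,
    forall f, d %| f -> e %| f -> l %| f &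
    forall f, d ^+ 2 %| f -> e ^+ 2 %| f -> l ^+ 2 %| f].
Proof.
move=> dm em; have d0 := monic_neq0 dm; have e0 := monic_neq0 em.
set g := gcdp d e; have g0 : g != 0 by rewrite gcdp_eq0 negb_and d0.
have dE : d = (d %/ g) * g by rewrite divpK ?dvdp_gcdl.
have eE : e = (e %/ g) * g by rewrite divpK ?dvdp_gcdr.
have co : coprimep (d %/ g) (e %/ g) by rewrite coprimep_div_gcd // d0.
set d' := d %/ g in dE co; set e' := e %/ g in eE co.
have d'0 : d' != 0 by apply: contraNneq d0 => h; rewrite dE h mul0r.
have e'0 : e' != 0 by apply: contraNneq e0 => h; rewrite eE h mul0r.
have l0 : d' * e' * g != 0 by rewrite !mulf_neq0.
set l := d' * e' * g in l0; set c := (lead_coef l)^-1.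
have c0 : c != 0 by rewrite invr_eq0 lead_coef_eq0.
exists (c *: l); split.
- by rewrite monicE lead_coefZ mulVf ?lead_coef_eq0.
- by rewrite dvdpZr // /l mulrAC -dE dvdp_mulr.
- by rewrite dvdpZr // /l -mulrA -eE dvdp_mull.
- move=> f /dvdpP[f1 ->]; rewrite {1}dE {1}eE mulrA dvdp_mul2r // => e'f1.
  rewrite dvdpZl // /l [X in _ %| _ * X]dE mulrA dvdp_mul2r // mulrC dvdp_mul2r //.
  by move: e'f1; rewrite mulrC Gauss_dvdpr // coprimep_sym.
- move=> f; rewrite {1}dE exprMn => /dvdpP[f1 ->].
  rewrite {1}eE exprMn [f1 * _]mulrA dvdp_mul2r ?expf_neq0 // => e'f1.
  have co2 : coprimep (e' ^+ 2) (d' ^+ 2).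
    by rewrite coprimep_expl // coprimep_expr // coprimep_sym.
  rewrite exprZn dvdpZl ?expf_neq0 // /l !exprMn.
  rewrite dvdp_mul2r ?expf_neq0 // mulrC dvdp_mul2r ?expf_neq0 //.
  by move: e'f1; rewrite mulrC Gauss_dvdpr.
Qed.

Section Squarefree.
Variable F : finFieldType.
Implicit Types d f g : {poly F}.

(** A bounded search keeps the predicate boolean; degrees up to [size f] are more than enough, as 2
    deg d <= deg f. The range is empty for f = 0, which thus counts as squarefree, whence the
    hypotheses f <> 0 below. *)
Definition sqfree f : bool :=
  all (fun k => all (fun d => ~~ (d ^+ 2 %| f)) (monics F k)) (iota 1 (size f)).

Lemma size_sqr_dvd d f : f != 0 -> d \is monic -> d ^+ 2 %| f ->
  ((size d).-1.*2 < size f)%N.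
Proof.
move=> f0 dm /(dvdp_leq f0); rewrite expr2 size_monicM ?monic_neq0 //.
have : size d != 0%N by rewrite size_poly_eq0 monic_neq0.
by case: (size d) => // k _; rewrite addSn addnS /= addnn.
Qed.

Lemma sqfreeP f : f != 0 ->
  reflect (forall d, d \is monic -> d ^+ 2 %| f -> d = 1) (sqfree f).
Proof.
move=> f0; apply: (iffP allP) => [sf d dm d2f|sf k].
  have := size_sqr_dvd f0 dm d2f; case k0: (size d).-1 => [|k] lt_kf.
    by have := monic_monics dm; rewrite k0 monics0 inE => /eqP.
  have /sf/allP/(_ d) : k.+1 \in iota 1 (size f) by rewrite mem_iota; lia.
  by rewrite -k0 monic_monics // d2f => /(_ isT).
rewrite mem_iota => /andP[k0 _]; apply/allP => d dk; apply/negP => d2f.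
have d1 := sf d (monics_monic dk) d2f.
by have := monics_size dk; rewrite d1 size_poly1 => [[k00]]; rewrite -k00 in k0.
Qed.

Lemma sqfree_mul f g : f * g != 0 -> sqfree (f * g) -> sqfree g.
Proof.
move=> fg0 /(sqfreeP fg0) sfg; apply/sqfreeP.
  by apply: contraNneq fg0 => ->; rewrite mulr0.
by move=> d dm d2g; apply: sfg => //; rewrite dvdp_mull.
Qed.

Lemma sqfree_XsubCM a f : f != 0 ->
  sqfree (('X - a%:P) * f) = sqfree f && ~~ root f a.
Proof.
move=> f0; have Xa0 : 'X - a%:P != 0 by rewrite polyXsubC_eq0.
have Xf0 : ('X - a%:P) * f != 0 by rewrite mulf_neq0.
apply/idP/andP => [sXf|[sf nfa]].
  split; first exact: sqfree_mul sXf.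
  apply/negP; rewrite -dvdp_XsubCl => Xf.
  have := (sqfreeP Xf0 sXf) _ (monicXsubC a).
  rewrite expr2 dvdp_mul2l // => /(_ Xf)/(congr1 (fun p => size (p : {poly F}))).
  by rewrite size_XsubC size_poly1.
apply/sqfreeP => // d dm d2; apply: (sqfreeP f0 sf) => //.
rewrite -(@Gauss_dvdpr _ _ ('X - a%:P)) // coprimep_expl //.
rewrite coprimep_XsubC; apply/negP; rewrite -dvdp_XsubCl => Xd.
have : ('X - a%:P) ^+ 2 %| ('X - a%:P) * f by apply: dvdp_trans d2; exact: dvdp_sqr.
by rewrite expr2 dvdp_mul2l // dvdp_XsubCl (negPf nfa).
Qed.

Section Counts.
Variable R : comNzRingType.
Local Notation q := (#|F|%:R : R).

Definition count_sqf n : R := \sum_(f <- monics F n | ~~ root f 0 && sqfree f) 1.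

(** K is free above n / 2, since larger k contribute 0; this lets the sums for n + 2 and n be
    aligned by a shift of k. *)
Lemma count_sqfE n K : (n < K.*2)%N -> count_sqf n =
  \sum_(k < K) if (k.*2 <= n)%N then mobius_nz F R k * count_nz F R (n - k.*2) else 0.
Proof.
move=> nK; under eq_bigr => k _ do rewrite -[mobius_nz F R k]mulr1.
rewrite -(sum_mobius_sqr F _ _ (fun=> 1)) /count_sqf big_mkcondr /=.
rewrite big_seq_cond [RHS]big_seq_cond; apply: eq_bigr => f /andP[fn _].
have f0 : f != 0 by rewrite monic_neq0 // (monics_monic fn).
under eq_bigr => k _ do under eq_bigr => d _ do rewrite mulr1.
case: K nK => // K nK.
rewrite (@sum_mobius_ideal _ _ (fun d => d ^+ 2 %| f) (sqfree f)).
- by case: ifP.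
- by rewrite expr1n dvd1p.
- by move=> d e _ _ /dvdp_sqr/dvdp_trans; apply.
- move=> d e dm em d2 e2; have [l [lm dl el _ l2]] := monic_lcm dm em.
  by exists l; split => //; apply: l2.
- move=> d dm /(size_sqr_dvd f0 dm); rewrite (monics_size fn); lia.
- exact: sqfreeP.
Qed.

Lemma count_sqf0 : count_sqf 0 = 1.
Proof. by rewrite (@count_sqfE _ 1) // big_ord1 mobius_nz0 count_nz0 mulr1. Qed.

Lemma count_sqf1 : count_sqf 1 = q - 1.
Proof.
by rewrite (@count_sqfE _ 1) // big_ord1 mobius_nz0 count_nzS mul1r expr1 expr0.
Qed.

(** [mobius_nz] is constant in positive degrees, so the terms k >= 2 of the sum for n + 2 are the
    terms k >= 1 of the sum for n; only the initial terms differ. *)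
Lemma count_sqfSS n :
  count_sqf n.+2 = count_sqf n + count_nz F R n.+2 - q * count_nz F R n.
Proof.
rewrite (@count_sqfE _ n.+3); last by lia.
rewrite big_ord_recl /= mobius_nz0 mul1r subn0.
rewrite (@count_sqfE n n.+2); last by lia.
rewrite [X in _ + X]big_ord_recl [X in _ = X + _ - _]big_ord_recl /=.
rewrite mobius_nz0 mobius_nzS mul1r.
rewrite [X in _ + (_ + X) = _](eq_bigr (fun i : 'I_n.+1 =>
  if ((bump 0 i).*2 <= n)%N
  then mobius_nz F R (bump 0 i) * count_nz F R (n - (bump 0 i).*2) else 0)).
  have -> : (n.+2 - (bump 0 0).*2 = n)%N by rewrite /bump /= -muln2; lia.
  by rewrite subn0; ring.
by move=> i _; rewrite /bump /= !add1n !mobius_nzS doubleS !ltnS subSS.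
Qed.

(** The generating series is (1 - q T^2) / ((1 - q T) (1 + T)); the pole at -1 gives the alternating
    term. The factor q + 1 stays on the left because R is only a ring. *)
Lemma count_sqf_closed n :
  (q + 1) * count_sqf n.+1 = (q - 1) * (q ^+ n.+1 - (- 1) ^+ n.+1).
Proof.
elim/ltn_ind: n => -[|[|n]] IHn; first by rewrite count_sqf1 !expr1; ring.
  rewrite count_sqfSS count_sqf0 count_nz0 count_nzS expr1 sqrrN expr1n; ring.
rewrite count_sqfSS !count_nzS mulrBr mulrDr IHn //.
by rewrite !exprS; ring.
Qed.

Definition count_sqf_nz (a : F) n : R :=
  \sum_(f <- monics F n | ~~ root f 0 && ~~ root f a && sqfree f) 1.

Lemma count_sqf_nz0 a : count_sqf_nz a 0 = 1.
Proof.
have s1 : sqfree 1.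
  apply/sqfreeP => [|d dm]; first exact: oner_neq0.
  rewrite dvdp1 expr2 size_monicM ?monic_neq0 // => sd.
  apply: monic_eqp; rewrite ?monic1 // -size_poly_eq1.
  have : size d != 0%N by rewrite size_poly_eq0 monic_neq0.
  by move: sd; case: (size d) => [|[|m]] //=; rewrite addnS.
by rewrite /count_sqf_nz monics0 big_cons big_nil !rootC oner_eq0 s1 addr0.
Qed.

(** A squarefree polynomial with root a is (X - a) g with g squarefree and g(a) <> 0, so these are
    counted by the same function one degree lower. *)
Lemma count_sqf_nzS a n : a != 0 ->
  count_sqf_nz a n.+1 = count_sqf n.+1 - count_sqf_nz a n.
Proof.
move=> a0; apply/eqP; rewrite eq_sym subr_eq; apply/eqP.
rewrite /count_sqf (bigID (fun f => root f a)) /= addrC.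
congr (_ + _).
  by apply: eq_bigl => f; rewrite andbAC.
under eq_bigl => f do rewrite -(dvdp_XsubCl f a).
rewrite (big_monics_dvd _ _ _ (XsubC_monics a)) /= subSS subn0 /count_sqf_nz.
rewrite big_seq_cond [RHS]big_seq_cond; apply: eq_bigl => f.
case fn : (f \in _) => //=; rewrite sqfree_XsubCM ?monic_neq0 ?(monics_monic fn) //.
rewrite rootM root_XsubC eq_sym negb_or a0 /=.
by case: (root f 0); case: (root f a); case: (sqfree f).
Qed.
End Counts.
End Squarefree.

(** * The square of the ideal (pi, d) *)

Section Polys.
Variable F : finFieldType.

Definition polys n : seq {poly F} := [seq rVpoly b | b : 'rV[F]_n].

Lemma mem_polys n b : (b \in polys n) = (size b <= n)%N.
Proof.
apply/fintype.imageP/idP => [[a _ ->]|sb]; first exact: size_poly.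
by exists (poly_rV b) => //; rewrite poly_rV_K.
Qed.

Lemma polys_uniq n : uniq (polys n).
Proof. by rewrite map_inj_uniq ?enum_uniq //; exact: can_inj rVpolyK. Qed.

Lemma size_polys n : size (polys n) = (#|F| ^ n)%N.
Proof. by rewrite size_image card_mx mul1n. Qed.

(** The solutions are b = d g - c with deg g < n - k. *)
Lemma sum_polys_dvd (R : comNzRingType) n k (c d : {poly F}) : (size c <= n)%N ->
  d \in monics F k -> (k <= n)%N ->
  \sum_(b <- polys n | d %| c + b) 1 = #|F|%:R ^+ (n - k) :> R.
Proof.
move=> sc dk le_kn; have dm := monics_monic dk; have ds := monics_size dk.
have -> : #|F|%:R ^+ (n - k) = \sum_(b <- [seq d * g - c | g <- polys (n - k)]) 1 :> R.
  by rewrite big_const_seq count_predT size_map size_polys iter_addr_0 natrX.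
rewrite -big_filter; apply: perm_big; apply: uniq_perm.
- exact/filter_uniq/polys_uniq.
- rewrite map_inj_uniq ?polys_uniq // => g h /addIr/mulfI; apply; exact: monic_neq0.
move=> b; rewrite mem_filter mem_polys; apply/andP/mapP => [[/dvdpP[g cb] sb]|[g]].
  exists g; last by rewrite mulrC -cb addrAC subrr add0r.
  have [->|g0] := eqVneq g 0; first by rewrite mem_polys size_poly0.
  have : (size (c + b)%R <= n)%N by rewrite (leq_trans (size_polyD _ _)) // geq_max sc.
  by rewrite cb size_Mmonic // ds addnS /= mem_polys leq_subRL // addnC.
rewrite mem_polys => sg ->; rewrite addrC subrK dvdp_mulr //; split=> //.
rewrite (leq_trans (size_polyD _ _)) // size_polyN geq_max sc andbT.
have [->|g0] := eqVneq g 0; first by rewrite mulr0 size_poly0.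
by rewrite size_monicM // ds addSn /= -leq_subRL.
Qed.

End Polys.

Section Residue.
Variables (Z : idomainType) (F : fieldType) (red : {rmorphism Z -> F}).
Variables (pi : Z) (L : F -> Z).
Hypotheses (pi_neq0 : pi != 0) (red_pi : red pi = 0).
Hypothesis redP : forall x, red x = 0 -> exists y, x = pi * y.
Hypotheses (LK : cancel L red) (L0 : L 0 = 0) (L1 : L 1 = 1).
Local Notation rp := (map_poly red).
Local Notation Lp := (map_poly L).
Implicit Types (d e l : {poly F}) (f g h : {poly Z}).

Lemma lift_polyK : cancel Lp rp.
Proof. by move=> d; apply/polyP => i; rewrite coef_map /= coef_map_id0 //= LK. Qed.

Lemma size_lift d : size (Lp d) = size d.
Proof. exact: size_map_inj_poly (can_inj LK) L0 _. Qed.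

Lemma lift_monic d : d \is monic -> Lp d \is monic.
Proof.
by move=> /monicP dm; rewrite monicE (lead_coef_map_inj (can_inj LK)) // dm L1.
Qed.

Lemma rp_pi f : rp (pi%:P * f) = 0.
Proof. by rewrite rmorphM /= map_polyC /= red_pi mul0r. Qed.

Lemma rp_eq0 f : rp f = 0 -> exists g, f = pi%:P * g.
Proof.
elim/poly_ind: f => [_|f c IHf f0]; first by exists 0; rewrite mulr0.
have /redP[y cE] : red c = 0.
  by have /polyP/(_ 0%N) := f0; rewrite coef_map coef0 coefD coefMX coefC /= add0r.
have /IHf[g fE] : rp f = 0.
  apply/polyP => i; have /polyP/(_ i.+1) := f0.
  by rewrite !coef_map !coef0 coefD coefMX coefC /= addr0.
by exists (g * 'X + y%:P); rewrite fE cE mulrDr mulrA polyCM.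
Qed.

Lemma rp_eq f g : rp f = rp g -> exists h, f = g + pi%:P * h.
Proof.
move=> fg; have /rp_eq0[h hE] : rp (f - g) = 0 by rewrite rmorphB /= fg subrr.
by exists h; rewrite -hE addrC subrK.
Qed.

Lemma mulpiI : injective ( *%R (pi%:P : {poly Z})).
Proof. by apply: mulfI; rewrite polyC_eq0. Qed.

(* f lies in the square of the ideal (pi, d) of Z[x]. *)
Definition in_sqr d f := exists D A B C,
  rp D = d /\ f = D ^+ 2 * A + pi%:P * (D * B) + pi%:P ^+ 2 * C.

(** Membership does not depend on the lift of d: replacing D by D + pi E changes only B and C. *)
Lemma in_sqr_lift D f : in_sqr (rp D) f -> exists A B C,
  f = D ^+ 2 * A + pi%:P * (D * B) + pi%:P ^+ 2 * C.
Proof.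
move=> [D' [A [B [C [/rp_eq[E ->] ->]]]]].
by exists A, (2%:R * E * A + B), (E ^+ 2 * A + E * B + C); ring.
Qed.

Lemma in_sqrB d f g : in_sqr d f -> in_sqr d g -> in_sqr d (f - g).
Proof.
move=> [D [A [B [C [<- ->]]]]] /in_sqr_lift[A' [B' [C' ->]]].
by exists D, (A - A'), (B - B'), (C - C'); split => //; ring.
Qed.

Lemma in_sqrN d f : in_sqr d f -> in_sqr d (- f).
Proof.
move=> [D [A [B [C [<- ->]]]]].
by exists D, (- A), (- B), (- C); split => //; ring.
Qed.

Lemma in_sqrD d f g : in_sqr d f -> in_sqr d g -> in_sqr d (f + g).
Proof. by move=> df /in_sqrN dg; rewrite -[g]opprK; exact: in_sqrB. Qed.

Lemma in_sqr_dvd d e f : d %| e -> in_sqr e f -> in_sqr d f.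
Proof.
move=> /dvdpP[c eE]; have -> : e = rp (Lp c * Lp d).
  by rewrite rmorphM /= !lift_polyK.
move=> /in_sqr_lift[A [B [C ->]]].
exists (Lp d), (Lp c ^+ 2 * A), (Lp c * B), C; split; first exact: lift_polyK.
by ring.
Qed.

Lemma in_sqr_red d f : in_sqr d f -> d ^+ 2 %| rp f.
Proof.
move=> [D [A [B [C [<- ->]]]]]; rewrite !rmorphD /= expr2 -!mulrA !rp_pi !addr0.
by rewrite !rmorphM /= mulrA dvdp_mulr.
Qed.

(** For a multiple of pi the quadratic condition becomes linear: D^2 A vanishes modulo pi, so A is
    itself a multiple of pi and one factor pi cancels. *)
Lemma in_sqr_pi d h : d != 0 -> in_sqr d (pi%:P * h) <-> d %| rp h.
Proof.
move=> d0; split=> [[D [A [B [C [DE hE]]]]]|/dvdpP[b hE]].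
  have /rp_eq0[A' AE] : rp A = 0.
    have := congr1 rp hE; rewrite !rmorphD /= expr2 -!mulrA !rp_pi !addr0 mulrA.
    rewrite !rmorphM /= DE => /esym/eqP; rewrite -expr2 mulf_eq0 expf_eq0 /= (negPf d0) /=.
    by move/eqP.
  have /mulpiI-> : pi%:P * h = pi%:P * (D ^+ 2 * A' + D * B + pi%:P * C).
    by rewrite hE AE; ring.
  by rewrite !rmorphD /= rp_pi addr0 expr2 -mulrA !rmorphM /= DE -mulrDr dvdp_mulr.
have /rp_eq[C ->] : rp h = rp (Lp d * Lp b).
  by rewrite hE rmorphM /= !lift_polyK mulrC.
by exists (Lp d), 0, (Lp b), C; split; [exact: lift_polyK|ring].
Qed.

(** Modulo pi, l^2 divides f. Subtracting a lift of that factorisation leaves pi h, and for such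
    elements membership means that d, e, hence l, divide h modulo pi. *)
Lemma in_sqr_lcm d e l f : d != 0 -> e != 0 -> l != 0 -> d %| l -> e %| l ->
  (forall m : {poly F}, d %| m -> e %| m -> l %| m) ->
  (forall m : {poly F}, d ^+ 2 %| m -> e ^+ 2 %| m -> l ^+ 2 %| m) ->
  in_sqr d f -> in_sqr e f -> in_sqr l f.
Proof.
move=> d0 e0 l0 dl el lcm1 lcm2 df ef.
have /dvdpP[q fE] := lcm2 _ (in_sqr_red df) (in_sqr_red ef).
have /rp_eq[h hE] : rp f = rp (Lp l ^+ 2 * Lp q).
  by rewrite fE rmorphM rmorphXn /= !lift_polyK mulrC.
have lq : in_sqr l (Lp l ^+ 2 * Lp q).
  by exists (Lp l), (Lp q), 0, 0; rewrite lift_polyK; split => //; ring.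
have {}hE : pi%:P * h = f - Lp l ^+ 2 * Lp q by rewrite hE addrAC subrr add0r.
have -> : f = Lp l ^+ 2 * Lp q + pi%:P * h by rewrite hE addrC subrK.
apply: in_sqrD => //; apply/(in_sqr_pi _ l0)/lcm1.
  by apply/(in_sqr_pi _ d0); rewrite hE; apply: in_sqrB df (in_sqr_dvd dl lq).
by apply/(in_sqr_pi _ e0); rewrite hE; apply: in_sqrB ef (in_sqr_dvd el lq).
Qed.

Definition no_sqr f := forall d, d \is monic -> in_sqr d f -> d = 1.
End Residue.

Lemma size_monic_sub (R : nzRingType) (f g : {poly R}) n : f \is monic -> g \is monic ->
  size f = n.+1 -> size g = n.+1 -> (size (f - g)%R <= n)%N.
Proof.
move=> /monicP fm /monicP gm fs gs; apply/leq_sizeP => j; rewrite leq_eqVlt.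
case/predU1P => [<-|lt_nj]; last by rewrite coefB !nth_default ?subrr ?fs ?gs.
by move: fm gm; rewrite !lead_coefE fs gs /= coefB => -> ->; rewrite subrr.
Qed.

Section SquareIdealCount.
Variables (Z : idomainType) (F : finFieldType) (red : {rmorphism Z -> F}).
Variables (pi : Z) (L : F -> Z).
Hypotheses (pi_neq0 : pi != 0) (red_pi : red pi = 0).
Hypothesis redP : forall x, red x = 0 -> exists y, x = pi * y.
Hypotheses (LK : cancel L red) (L0 : L 0 = 0) (L1 : L 1 = 1).
Local Notation rp := (map_poly red).
Local Notation Lp := (map_poly L).
Implicit Types (d f b : {poly F}).

(** Once d^2 divides the first digit f = d^2 q, the condition on the second digit is affine. The
    shift c is the first-order defect ([Lp f] - [Lp d ^+ 2 * Lp q]) / pi, of degree below n because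
    both polynomials are monic of degree n. *)
Lemma in_sqr_digits n f d : f \in monics F n -> d \is monic -> d ^+ 2 %| f ->
  exists2 c : {poly F}, (size c <= n)%N &
  forall b, in_sqr red pi d (Lp f + pi%:P * Lp b) <-> d %| c + b.
Proof.
move=> fn dm /dvdpP[q fE].
have fm := monics_monic fn; have d0 := monic_neq0 dm.
have qm : q \is monic by move: fm; rewrite fE monicMr ?monic_exp.
have gm : Lp d ^+ 2 * Lp q \is monic.
  by rewrite monicMl ?monic_exp ?(lift_monic LK L0 L1).
have gE : rp (Lp d ^+ 2 * Lp q) = f.
  by rewrite rmorphM rmorphXn /= !(lift_polyK LK) // fE mulrC.
have [c cE] : exists c, Lp f = Lp d ^+ 2 * Lp q + pi%:P * c.
  by apply: (rp_eq redP); rewrite gE (lift_polyK LK).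
exists (rp c).
  apply: leq_trans (size_poly _ _) _; rewrite -(@size_scale _ pi) // -mul_polyC.
  have -> : pi%:P * c = Lp f - Lp d ^+ 2 * Lp q by rewrite cE addrAC subrr add0r.
  apply: size_monic_sub.
  - exact: lift_monic.
  - exact: gm.
  - by rewrite (size_lift LK) // (monics_size fn).
  by rewrite -(monics_size fn) -gE size_map_poly_id0 // (monicP gm) rmorph1 oner_neq0.
move=> b; have -> : Lp f + pi%:P * Lp b = Lp d ^+ 2 * Lp q + pi%:P * (c + Lp b).
  by rewrite cE mulrDr addrA.
have dq : in_sqr red pi d (Lp d ^+ 2 * Lp q).
  by exists (Lp d), (Lp q), 0, 0; rewrite (lift_polyK LK) //; split => //; ring.
have -> : rp c + b = rp (c + Lp b) by rewrite rmorphD /= (lift_polyK LK).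
rewrite -(in_sqr_pi pi_neq0 red_pi redP LK L0 _ d0); split => [sD|s].
  have -> : pi%:P * (c + Lp b) =
    Lp d ^+ 2 * Lp q + pi%:P * (c + Lp b) - Lp d ^+ 2 * Lp q.
    by rewrite addrAC subrr add0r.
  exact (in_sqrB redP sD dq).
exact (in_sqrD redP dq s).
Qed.

Variable R : comNzRingType.

Lemma count_no_sqr n K : (n < K.*2)%N ->
  \sum_(f <- monics F n | ~~ root f 0)
    \sum_(b <- polys F n | `[< no_sqr red pi (Lp f + pi%:P * Lp b) >]) 1 =
  \sum_(k < K) if (k.*2 <= n)%N then
    mobius_nz F R k * #|F|%:R ^+ (n - k) * count_nz F R (n - k.*2) else 0.
Proof.
move=> nK; rewrite -(sum_mobius_sqr F _ _ (fun k => #|F|%:R ^+ (n - k))).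
rewrite big_seq_cond [RHS]big_seq_cond; apply: eq_bigr => f /andP[fn _].
have fm := monics_monic fn; have f0 := monic_neq0 fm.
have fl := lift_monic LK L0 L1 fm.
have rpE b : rp (Lp f + pi%:P * Lp b) = f.
  by rewrite rmorphD /= (rp_pi red_pi) addr0 (lift_polyK LK).
transitivity (\sum_(b <- polys F n) \sum_(k < K)
   \sum_(d <- monics F k | `[< in_sqr red pi d (Lp f + pi%:P * Lp b) >]) mobius R d).
  rewrite big_mkcond /=; apply: eq_bigr => b _; case: K nK => // K nK.
  set P := fun d => `[< in_sqr red pi d (Lp f + pi%:P * Lp b) >].
  set t := `[< _ >].
  rewrite (@sum_mobius_ideal _ _ P t) //; first by case: t.
  - apply/asboolP; exists 1, (Lp f + pi%:P * Lp b), 0, 0.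
    by split; [rewrite rmorph1|ring].
  - by move=> d e _ _ de /asboolP e_in; apply/asboolP/(in_sqr_dvd redP LK L0 de).
  - move=> d e dm em /asboolP d_in /asboolP e_in.
    have [l [lm dl el l1 l2]] := monic_lcm dm em.
    exists l; split => //; apply/asboolP.
    by apply: (in_sqr_lcm pi_neq0 red_pi redP LK L0 _ _ _ dl el l1 l2 d_in e_in);
      exact: monic_neq0.
  - move=> d dm /asboolP/(in_sqr_red red_pi); rewrite rpE => /(size_sqr_dvd f0 dm).
    by rewrite (monics_size fn); lia.
  - apply: (iffP (asboolP _)) => h d dm; first by move/asboolP/(h d dm).
    by move=> d_in; apply: h => //; apply/asboolP.
rewrite exchange_big /=; apply: eq_bigr => k _.
rewrite (exchange_big_dep xpredT) //= [RHS]big_mkcond /=.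
apply: eq_big_seq => d dk; have dm := monics_monic dk.
(* Only d with d^2 | f contribute; each of them fixes b modulo d and leaves q ^ (n - k) second
   digits. *)
case: ifPn => d2f; last first.
  apply: big1 => b /asboolP/(in_sqr_red red_pi).
  by rewrite rpE (negPf d2f).
have [c sc cP] := in_sqr_digits fn dm d2f.
have le_kn : (k <= n)%N.
  have := size_sqr_dvd f0 dm d2f; rewrite (monics_size fn) (monics_size dk) /=.
  by lia.
rewrite -(sum_polys_dvd R sc dk le_kn) mulr_sumr.
apply: eq_big => [b|b _]; last by rewrite mulr1.
by apply/asboolP/idP => /cP.
Qed.
End SquareIdealCount.

(** * Discriminants modulo the square of a prime *)

Lemma sqr_dvd_deriv (F : fieldType) (d f : {poly F}) : d ^+ 2 %| f -> d %| f^`().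
Proof.
move=> /dvdpP[g ->]; rewrite expr2 mulrA derivM.
by apply: dvdp_add; [exact: dvdp_mull | exact/dvdp_mulr/dvdp_mull].
Qed.

(** Finite fields are perfect: a divisor u with zero derivative is w ^ p, with the coefficients of w
    obtained from the inverse of Frobenius; then w^2 divides f, so w and u are constant. *)
Lemma sqfree_separable (F : finFieldType) (f : {poly F}) :
  f != 0 -> sqfree f -> separable_poly f.
Proof.
move=> f0 /(sqfreeP f0) sf.
have sz1 d : d ^+ 2 %| f -> (size d <= 1)%N.
  move=> d2f; have d0 : d != 0.
    by apply: contraNneq f0 => d0; move: d2f; rewrite d0 expr0n /= dvd0p.
  have : (lead_coef d)^-1 *: d = 1.
    apply: sf; first by rewrite monicE lead_coefZ mulVf ?lead_coef_eq0.
    by rewrite exprZn dvdpZl ?expf_neq0 ?invr_eq0 ?lead_coef_eq0.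
  move/(congr1 (fun p => size (p : {poly F}))).
  by rewrite size_scale ?invr_eq0 ?lead_coef_eq0 // size_poly1 => ->.
apply/separable_polyP; split=> [u v uvf|u uf su].
  rewrite /coprimep eqn_leq sz1 ?size_poly_gt0; last first.
    by apply: dvdp_trans uvf; rewrite expr2 dvdp_mul ?dvdp_gcdl ?dvdp_gcdr.
  rewrite gcdp_eq0 negb_and; apply/orP; left.
  by apply: contraNneq f0 => u0; move: uvf; rewrite u0 mul0r dvd0p.
apply/negP => /eqP u'0; have [p p_pr p_char] := finPcharP F.
have p_charX : p \in [pchar {poly F}] by rewrite pchar_poly.
have frob_inj : injective (pFrobenius_aut p_char) := fmorph_inj _.
pose w := \poly_(j < size u) invF frob_inj u`_(j * p).
have uE : u = w ^+ p.
  rewrite -(pFrobenius_autE p_charX) /w poly_def rmorph_sum /=.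
  apply/polyP => i; rewrite coef_sum.
  under eq_bigr => j _.
    rewrite pFrobenius_autE exprZn -exprM coefZ coefXn -(pFrobenius_autE p_char) f_invF.
    over.
  have [/dvdnP[j ->]|ndvd] := boolP (p %| i)%N; last first.
    rewrite big1 => [|j _]; last first.
      by case: eqP ndvd => [->|_ _]; rewrite ?dvdn_mull // mulr0.
    case: i ndvd => [|i] ndvd; first by rewrite dvdn0 in ndvd.
    have /eqP := congr1 (fun h : {poly F} => h`_i) u'0.
    rewrite coef_deriv coef0 -mulr_natr mulf_eq0 => /orP[/eqP//|].
    by rewrite -(dvdn_pcharf p_char) (negPf ndvd).
  have [lt_ju|le_uj] := ltnP j (size u).
    rewrite (bigD1 (Ordinal lt_ju)) //= eqxx mulr1 big1 ?addr0 // => k nkj.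
    rewrite eqn_pmul2r ?prime_gt0 // eq_sym.
    by rewrite -[k == j :> nat]/(k == Ordinal lt_ju) (negPf nkj) mulr0.
  rewrite nth_default ?(leq_trans le_uj) ?leq_pmulr ?prime_gt0 //.
  rewrite big1 // => k _; rewrite eqn_pmul2r ?prime_gt0 //.
  by rewrite gtn_eqF ?mulr0 // (leq_trans _ le_uj).
have : (size w <= 1)%N.
  by apply: sz1; apply: dvdp_trans uf; rewrite uE dvdp_exp2l // prime_gt1.
move=> /size1_polyC wE; move: su; rewrite uE wE -rmorphXn /= size_polyC.
by case: eqP.
Qed.

(** Row vectors are pairs (u, v) with deg u < deg g and deg v < deg f, and the matrix sends such a
    pair to u f + v g. Kernel computations become statements about such combinations. *)
Lemma mul_Sylvester (R : nzRingType) (f g : {poly R})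
    (w : 'rV[R]_((size g).-1 + (size f).-1)) :
  w *m Sylvester_mx f g = poly_rV (rVpoly (lsubmx w) * f + rVpoly (rsubmx w) * g).
Proof. by rewrite -{1}[w]hsubmxK mul_row_col !mul_rV_lin1 linearD. Qed.

Lemma size_Sylvester (R : nzRingType) (f g : {poly R})
    (w : 'rV[R]_((size g).-1 + (size f).-1)) :
  (size (rVpoly (lsubmx w) * f + rVpoly (rsubmx w) * g)%R <= (size g).-1 + (size f).-1)%N.
Proof.
rewrite (leq_trans (size_polyD _ _)) // geq_max.
rewrite !(leq_trans (size_polyMleq _ _)) // -subn1 leq_subLR.
  by rewrite (leq_trans (leq_add (size_poly _ _) (leqSpred _))) // addnS add1n addnC.
by rewrite (leq_trans (leq_add (size_poly _ _) (leqSpred _))) // addnS add1n.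
Qed.

(** * Replacing a row, and determinants divisible by pi^2 *)

Section RowReplace.
Variables (R : comNzRingType) (n : nat).
Implicit Types (v w : 'rV[R]_n) (A : 'M[R]_n).

Definition repl_row (i : 'I_n) (w : 'rV[R]_n) (A : 'M[R]_n) : 'M[R]_n :=
  \matrix_(k, j) if k == i then w 0 j else A k j.

Lemma cofactor_repl_row i w A j : cofactor (repl_row i w A) i j = cofactor A i j.
Proof.
by congr (_ * \det _); apply/matrixP => k l; rewrite !mxE eq_sym (negPf (neq_lift _ _)).
Qed.

(** Expansion along row i yields the i-th entry of v A adj(A) = det(A) v. *)
Lemma det_repl_row i v A : v 0 i = 1 -> \det (repl_row i (v *m A) A) = \det A.
Proof.
move=> vi; rewrite (expand_det_row _ i).
under eq_bigr => j _ do rewrite cofactor_repl_row mxE eqxx.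
transitivity ((v *m A *m \adj A) 0 i).
  by rewrite [in RHS]mxE; apply: eq_bigr => j _; rewrite [\adj A _ _]mxE.
by rewrite -mulmxA mul_mx_adj mul_mx_scalar mxE vi mulr1.
Qed.

Lemma det_repl_rowZ i c w A :
  \det (repl_row i (c *: w) A) = c * \det (repl_row i w A).
Proof.
rewrite !(expand_det_row _ i) mulr_sumr; apply: eq_bigr => j _.
by rewrite !cofactor_repl_row !mxE eqxx -mulrA.
Qed.

Lemma mul_repl_row i w A v :
  v *m repl_row i w A = v 0 i *: w + (v - v 0 i *: delta_mx 0 i) *m A.
Proof.
apply/rowP => j; rewrite !mxE (bigD1 i) //= mxE eqxx; congr (_ + _).
rewrite [RHS](bigD1 i) //= !mxE !eqxx mulr1 subrr mul0r add0r.
by apply: eq_bigr => k nki; rewrite !mxE (negPf nki) !andbF !mulr0 subr0.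
Qed.
End RowReplace.

Section Residue.
Variables (Z : idomainType) (F : fieldType) (red : {rmorphism Z -> F}).
Variables (pi : Z) (L : F -> Z).
Hypotheses (pi_neq0 : pi != 0) (red_pi : red pi = 0).
Hypothesis redP : forall x, red x = 0 -> exists y, x = pi * y.
Hypotheses (LK : cancel L red) (L1 : L 1 = 1).
Local Notation rp := (map_poly red).
Local Notation Lp := (map_poly L).
Local Notation rm := (map_mx red).

Lemma lift_mxK m n : cancel (@map_mx _ _ L m n) rm.
Proof. by move=> A; apply/matrixP => i j; rewrite !mxE LK. Qed.

Lemma rm_eq0 m n (A : 'M[Z]_(m, n)) : rm A = 0 -> exists B, A = pi *: B.
Proof.
move=> A0; have ex i j : exists y, A i j == pi * y.
  have /redP[y yE] : red (A i j) = 0 by have /matrixP/(_ i j) := A0; rewrite !mxE.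
  by exists y; apply/eqP.
exists (\matrix_(i, j) xchoose (ex i j)); apply/matrixP => i j; rewrite !mxE.
exact/eqP/(xchooseP (ex i j)).
Qed.

Section Det.
Variables (n : nat) (A : 'M[Z]_n).

Lemma det_repl_div i (v : 'rV[F]_n) : v 0 i = 1 -> v *m rm A = 0 ->
  exists w, map_mx L v *m A = pi *: w /\ \det A = pi * \det (repl_row i w A).
Proof.
move=> vi vA; have [w wE] : exists w, map_mx L v *m A = pi *: w.
  by apply: rm_eq0; rewrite map_mxM lift_mxK.
exists w; split => //; rewrite -det_repl_rowZ -wE det_repl_row // mxE vi //.
Qed.

(** The first kernel vector extracts one factor pi from row i. The second has coordinate 0 there,
    does not see the new row, and still kills the matrix modulo pi. *)
Lemma det_two_kernel i (v1 v2 : 'rV[F]_n) :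
  v1 0 i = 1 -> v2 0 i = 0 -> v2 != 0 ->
  v1 *m rm A = 0 -> v2 *m rm A = 0 -> exists c, \det A = pi ^+ 2 * c.
Proof.
move=> v1i v2i v20 v1A v2A; have [w [_ ->]] := det_repl_div v1i v1A.
have /redP[c ->] : red (\det (repl_row i w A)) = 0.
  rewrite -det_map_mx; apply/eqP/det0P; exists v2 => //.
  have -> : rm (repl_row i w A) = repl_row i (rm w) (rm A).
    by apply/matrixP => k j; rewrite !mxE; case: ifP.
  by rewrite mul_repl_row v2i !scale0r add0r subr0.
by exists c; rewrite mulrA.
Qed.

(* If v A = pi w with v_i = 1 then det A = pi det A', where A' is A with row i
   replaced by w; so pi^2 | det A makes A' singular modulo pi as well, and a
   kernel vector of A' is either a second kernel vector of A or corrects v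
   modulo pi^2. *)
Lemma det_sqr_kernel c : \det A = pi ^+ 2 * c ->
  (exists i (v1 v2 : 'rV[F]_n), [/\ v1 0 i = 1, v2 0 i = 0, v2 != 0,
     v1 *m rm A = 0 & v2 *m rm A = 0]) \/
  (exists v w : 'rV[Z]_n, rm v != 0 /\ v *m A = pi ^+ 2 *: w).
Proof.
move=> dA; have : \det (rm A) == 0.
  by rewrite det_map_mx dA rmorphM rmorphXn /= red_pi expr0n /= mul0r.
case/det0P => v /rV0Pn[i vi0] vA.
pose v1 := (v 0 i)^-1 *: v.
have v1i : v1 0 i = 1 by rewrite mxE mulVf.
have v1A : v1 *m rm A = 0 by rewrite -scalemxAl vA scaler0.
have [w [wE detE]] := det_repl_div v1i v1A.
have {}detE : \det (repl_row i w A) = pi * c.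
  by apply: (mulfI pi_neq0); rewrite -detE dA expr2 mulrA.
have rrE : rm (repl_row i w A) = repl_row i (rm w) (rm A).
  by apply/matrixP => k j; rewrite !mxE; case: ifP.
have : \det (rm (repl_row i w A)) == 0.
  by rewrite det_map_mx detE rmorphM /= red_pi mul0r.
case/det0P => v2 v20 v2A.
have [v2i|v2i] := eqVneq (v2 0 i) 0.
  left; exists i, v1, v2; split => //.
  by move: v2A; rewrite rrE mul_repl_row v2i !scale0r add0r subr0.
right; pose v3 := (v2 0 i)^-1 *: v2.
have v3i : v3 0 i = 1 by rewrite mxE mulVf.
have /rm_eq0[u uE] : rm (map_mx L v3 *m repl_row i w A) = 0.
  by rewrite map_mxM lift_mxK -scalemxAl v2A scaler0.
pose l3 := map_mx L v3; have l3i : l3 0 i = 1 by rewrite mxE v3i.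
exists (map_mx L v1 + pi *: (l3 - delta_mx 0 i)), u; split.
  rewrite map_mxD map_mxZ red_pi scale0r addr0 lift_mxK.
  by apply/rV0Pn; exists i; rewrite v1i oner_neq0.
rewrite mulmxDl wE -scalemxAl -scalerDr expr2 -scalerA; congr (_ *: _).
by rewrite -uE mul_repl_row l3i !scale1r.
Qed.
End Det.

(** * Resultants through the Sylvester matrix modulo pi *)

Section Sylvester.
Variables f g : {poly Z}.
Local Notation S := (Sylvester_mx f g).

Lemma mul_red_Sylvester (w : 'rV[F]_((size g).-1 + (size f).-1)) : w *m rm S = 0 <->
  rVpoly (lsubmx w) * rp f + rVpoly (rsubmx w) * rp g = 0.
Proof.
have -> : w *m rm S = poly_rV (rVpoly (lsubmx w) * rp f + rVpoly (rsubmx w) * rp g).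
  rewrite -{1}[w]lift_mxK -map_mxM mul_Sylvester map_poly_rV rmorphD !rmorphM /=.
  by rewrite !map_rVpoly map_lsubmx map_rsubmx lift_mxK.
split=> [/(congr1 rVpoly)|->]; last exact: linear0.
rewrite poly_rV_K ?linear0 //.
rewrite -[w]lift_mxK -map_lsubmx -map_rsubmx -!map_rVpoly -!rmorphM -rmorphD.
exact: leq_trans (size_poly _ _) (size_Sylvester _).
Qed.

Lemma red_Sylvester_row (u v : {poly F}) : (size u <= (size g).-1)%N ->
  (size v <= (size f).-1)%N -> u * rp f + v * rp g = 0 ->
  row_mx (poly_rV u) (poly_rV v) *m rm S = 0.
Proof.
by move=> su sv uv; apply/mul_red_Sylvester; rewrite row_mxKl row_mxKr !poly_rV_K.
Qed.

(** With f = f1 D and g = g1 D modulo pi, both (g1, -f1) and its multiple by X lie in the kernel;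
    deg D >= 2 leaves room for the second. *)
Lemma resultant_common_divisor (D : {poly F}) : rp f != 0 ->
  D %| rp f -> D %| rp g -> (2 < size D)%N -> exists c, resultant f g = pi ^+ 2 * c.
Proof.
move=> f0 /dvdpP[f1 fE] /dvdpP[g1 gE] sD.
have f10 : f1 != 0 by apply: contraNneq f0 => f10; rewrite fE f10 mul0r.
have D0 : D != 0 by rewrite -size_poly_gt0; lia.
have size1 (h : {poly Z}) (h1 : {poly F}) : rp h = h1 * D -> (size ('X * h1)%R <= (size h).-1)%N.
  move=> hE; have [->|h10] := eqVneq h1 0; first by rewrite mulr0 size_poly0.
  have : (size (rp h) <= size h)%N by apply: size_poly.
  rewrite hE size_mul // ['X * h1]mulrC size_mulX //.
  move: sD; move: (size D) (size h1) (size h) => i j k; lia.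
have size0 (h : {poly Z}) (h1 : {poly F}) : rp h = h1 * D -> (size h1 <= (size h).-1)%N.
  move=> /size1; have [->|h10] := eqVneq h1 0; first by rewrite size_poly0.
  by rewrite mulrC size_mulX // => /ltnW.
have lt_i : (size f1 < (size f).-1)%N.
  by have := size1 _ _ fE; rewrite mulrC size_mulX.
have l0 : - lead_coef f1 != 0 by rewrite oppr_eq0 lead_coef_eq0.
(* The pivot is the coefficient just above the degree of f1: it is the leading one of X f1 and is
   zero in f1. *)
pose i := rshift (size g).-1 (Ordinal lt_i).
pose v1 := row_mx (poly_rV ('X * g1)) (poly_rV (- ('X * f1))) : 'rV_((size g).-1 + (size f).-1).
pose v2 := row_mx (poly_rV g1) (poly_rV (- f1)) : 'rV_((size g).-1 + (size f).-1).
apply: (@det_two_kernel _ _ i ((- lead_coef f1)^-1 *: v1) v2).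
- rewrite mxE row_mxEr mxE coefN coefXM /= lead_coefE.
  by rewrite size_poly_eq0 (negPf f10) mulVf // -lead_coefE.
- by rewrite row_mxEr mxE coefN nth_default ?oppr0.
- apply/eqP => /(congr1 rsubmx); rewrite row_mxKr => /(congr1 rVpoly)/eqP.
  rewrite !linear0 poly_rV_K ?size_polyN; last exact: ltnW.
  by rewrite oppr_eq0 (negPf f10).
- rewrite -scalemxAl red_Sylvester_row ?scaler0 ?size_polyN ?size1 //.
  by rewrite fE gE; ring.
- rewrite red_Sylvester_row ?size_polyN ?size0 //.
  by rewrite fE gE; ring.
Qed.

Lemma resultant_common_root (a c d : Z) : (1 < size f)%N -> (1 < size g)%N ->
  f.[a] = pi ^+ 2 * c -> g.[a] = pi ^+ 2 * d -> exists e, resultant f g = pi ^+ 2 * e.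
Proof.
move=> sf sg fa ga; have [[u v] /= _ rE] := resultant_in_ideal sf sg.
exists (u.[a] * c + v.[a] * d).
by rewrite -[LHS](hornerC _ a) rE hornerD !hornerM fa ga; ring.
Qed.

(** A kernel vector (u, v) modulo pi would make f divide v, which has smaller degree. So not even pi
    divides the resultant. *)
Lemma resultant_coprime c : rp f != 0 -> size (rp f) = size f -> 
  coprimep (rp f) (rp g) -> resultant f g <> pi ^+ 2 * c.
Proof.
move=> f0 fs co rE; have : \det (rm S) == 0.
  by rewrite det_map_mx -/(resultant f g) rE rmorphM rmorphXn /= red_pi expr0n /= mul0r.
case/det0P => w w0 /mul_red_Sylvester wE.
have v0 : rVpoly (rsubmx w) = 0.
  apply/eqP; apply: contraT => v0.
  have : rp f %| rVpoly (rsubmx w).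
    rewrite -(Gauss_dvdpl _ co) -(dvdp_addr _ (dvdp_mull (rVpoly (lsubmx w)) (dvdpp _))).
    by rewrite wE dvdp0.
  move/(dvdp_leq v0)/leq_trans/(_ (size_poly _ _)); rewrite fs.
  by rewrite -size_poly_gt0 fs in f0; rewrite -ltnS prednK // ltnn.
move: wE w0; rewrite v0 mul0r addr0 => /eqP; rewrite mulf_eq0 (negPf f0) orbF.
move=> /eqP u0; rewrite -[w]hsubmxK.
by rewrite -[lsubmx w]rVpolyK u0 -[rsubmx w]rVpolyK v0 !linear0 row_mx0 eqxx.
Qed.

(** The gcd modulo pi is exactly X - a, so the kernel is the line spanned by (-k, h), which excludes
    the first alternative of [det_sqr_kernel]. In the second, u f + t g vanishes modulo pi^2 with
    (u, t) = e (-k, h) modulo pi and e <> 0. At a lift of a both t and g are multiples of pi, so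
    u(a) y = 0 modulo pi, while k(a) <> 0 by coprimality with h. *)
Lemma resultant_simple_root (h k : {poly F}) (a : F) y c :
  rp f != 0 -> size (rp f) = size f ->
  rp f = ('X - a%:P) * h -> rp g = ('X - a%:P) * k -> coprimep h k -> root h a ->
  f.[L a] = pi * y -> red y != 0 -> resultant f g <> pi ^+ 2 * c.
Proof.
move=> f0 fs fE gE co ha fa y0 rE.
have X0 : 'X - a%:P != 0 :> {poly F} by rewrite polyXsubC_eq0.
have h0 : h != 0 by apply: contraNneq f0 => h0; rewrite fE h0 mulr0.
have sh : size h = (size f).-1 by rewrite -fs fE size_monicM ?monicXsubC // size_XsubC.
have kerP (w : 'rV[F]_((size g).-1 + (size f).-1)) : w *m rm S = 0 ->
    exists e, rVpoly (lsubmx w) = - e *: k /\ rVpoly (rsubmx w) = e *: h.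
  move=> /mul_red_Sylvester; rewrite fE gE.
  set u := rVpoly _; set v := rVpoly _ => uv.
  have {}uv : u * h + v * k = 0.
    by apply: (mulfI X0); rewrite mulr0 -uv; ring.
  have /dvdpP[q vE] : h %| v.
    by rewrite -(Gauss_dvdpl _ co) -(dvdp_addr _ (dvdp_mull u (dvdpp h))) uv dvdp0.
  have sq : (size q <= 1)%N.
    have [->|q0] := eqVneq q 0; first by rewrite size_poly0.
    have : (size v <= (size f).-1)%N by apply: size_poly.
    rewrite vE size_mul // -sh -(leq_add2r (size h)).
    by move: h0; rewrite -size_poly_gt0; move: (size q) (size h) => i j; lia.
  move: vE; rewrite (size1_polyC sq) mul_polyC => vE; exists q`_0; split => //.
  apply: (mulIf h0); apply/eqP; rewrite -subr_eq0 -scalerAl scaleNr opprK mulrC.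
  by rewrite [k * h]mulrC scalerAl -vE [_ * u]mulrC uv.
case: (det_sqr_kernel rE) => [[i [v1 [v2 []]]]|[v [w []]]].
  move=> v1i v2i v20 /kerP[e1 [l1 r1]] /kerP[e2 [l2 r2]].
  pose z := row_mx (poly_rV (- k)) (poly_rV h) : 'rV[F]_((size g).-1 + (size f).-1).
  have zE e (w : 'rV_((size g).-1 + (size f).-1)) : rVpoly (lsubmx w) = - e *: k ->
      rVpoly (rsubmx w) = e *: h -> w = e *: z.
    move=> lw rw; rewrite -[w]hsubmxK -[lsubmx w]rVpolyK lw -[rsubmx w]rVpolyK rw.
    by rewrite scaleNr -scalerN !linearZ /= scale_row_mx.
  move: v1i v2i v20; rewrite (zE _ _ l1 r1) (zE _ _ l2 r2) !mxE => z1 /eqP.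
  rewrite mulf_eq0 => /orP[/eqP->|/eqP z0]; first by rewrite scale0r eqxx.
  by move/eqP: z1; rewrite z0 mulr0 eq_sym oner_eq0.
move=> v0 vw; have /kerP[e [lE rhE]] : rm v *m rm S = 0.
  by rewrite -map_mxM vw map_mxZ rmorphXn /= red_pi expr0n /= scale0r.
have e0 : e != 0.
  apply: contraNneq v0 => e0; move: lE rhE; rewrite e0 oppr0 !scale0r => lE rE0.
  rewrite -[rm v]hsubmxK -[lsubmx _]rVpolyK lE -[rsubmx _]rVpolyK rE0.
  by rewrite !linear0 row_mx0.
have := congr1 rVpoly vw; rewrite mul_Sylvester poly_rV_K ?size_Sylvester //.
rewrite linearZ /=; move: lE rhE.
rewrite -map_lsubmx -map_rsubmx -!map_rVpoly.
set u := rVpoly (lsubmx v); set t := rVpoly (rsubmx v) => uE tE.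
move/(congr1 (fun p => p.[L a])); rewrite hornerD !hornerM fa hornerZ.
have red_horner (q : {poly Z}) : red q.[L a] = (rp q).[a].
  by rewrite -[in RHS](LK a) horner_map.
have /redP[g1 ->] : red g.[L a] = 0.
  by rewrite red_horner gE hornerM hornerXsubC subrr mul0r.
have /redP[t1 ->] : red t.[L a] = 0.
  by rewrite red_horner tE hornerZ (rootP ha) mulr0.
set z := (rVpoly w).[_] => zE.
have /(congr1 red) : u.[L a] * y = pi * (z - t1 * g1).
  apply: (mulfI pi_neq0).
  have -> : pi * (pi * (z - t1 * g1)) = pi ^+ 2 * z - pi * t1 * (pi * g1) by ring.
  by rewrite -zE; ring.
rewrite !rmorphM /= red_pi mul0r red_horner uE hornerZ => /eqP.
rewrite !mulf_eq0 oppr_eq0 (negPf e0) (negPf y0) orbF /=.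
by apply/negP; rewrite (coprimep_root co ha).
Qed.
End Sylvester.
End Residue.

Lemma sqfree_coprime_deriv (F : finFieldType) (f : {poly F}) :
  f != 0 -> sqfree f -> coprimep f f^`().
Proof. by move=> f0 /(sqfree_separable f0); rewrite unlock. Qed.

Lemma horner_taylor2 (R : comNzRingType) (f : {poly R}) (x h : R) :
  exists r, f.[x + h] = f.[x] + f^`().[x] * h + r * h ^+ 2.
Proof.
elim/poly_ind: f => [|f c [r fE]]; first by exists 0; rewrite deriv0 !horner0; ring.
exists (f^`().[x] + r * (x + h)).
rewrite derivD derivC derivM derivX !(hornerD, hornerM, hornerX, hornerC) fE.
by ring.
Qed.

(** * The resultant of f and its derivative *)

Section ResultantDeriv.
Variables (Z : idomainType) (F : finFieldType) (red : {rmorphism Z -> F}).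
Variables (pi : Z) (L : F -> Z).
Hypotheses (pi_neq0 : pi != 0) (red_pi : red pi = 0).
Hypothesis redP : forall x, red x = 0 -> exists y, x = pi * y.
Hypotheses (LK : cancel L red) (L1 : L 1 = 1).
Local Notation rp := (map_poly red).
Variable f : {poly Z}.
Hypothesis f_monic : f \is monic.

Let rf_monic : rp f \is monic := monic_map _ f_monic.
Let rf_neq0 : rp f != 0 := monic_neq0 rf_monic.

Let size_rf : size (rp f) = size f.
Proof. by rewrite size_map_poly_id0 // (monicP f_monic) rmorph1 oner_neq0. Qed.

Let red_horner (g : {poly Z}) a : red g.[L a] = (rp g).[a].
Proof. by rewrite -[in RHS](LK a) horner_map. Qed.

Lemma resultant_deriv_sqfree c : sqfree (rp f) -> resultant f f^`() <> pi ^+ 2 * c.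
Proof.
move=> sf; apply: (resultant_coprime red_pi LK) => //.
by rewrite -deriv_map sqfree_coprime_deriv.
Qed.

(** The derivative has a simple root at a modulo pi, since f''(a) = 2 g(a) <> 0. If pi^2 divides
    f(a), moving a by a multiple of pi makes f' vanish modulo pi^2 as well, and the resultant lies
    in the ideal (f, f'). The converse is the simple common root case. *)
Lemma resultant_deriv_double a g : 2%:R != 0 :> F ->
  rp f = ('X - a%:P) ^+ 2 * g -> sqfree g -> ~~ root g a ->
  (exists c, resultant f f^`() = pi ^+ 2 * c) <-> (exists c, f.[L a] = pi ^+ 2 * c).
Proof.
move=> two0 fE sg ga; have g0 : g != 0 by apply: contraNneq ga => ->; rewrite root0.
pose h := ('X - a%:P) * g; pose k := 2%:R * g + ('X - a%:P) * g^`().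
have fEh : rp f = ('X - a%:P) * h by rewrite fE /h; ring.
have gE : rp f^`() = ('X - a%:P) * k.
  by rewrite -deriv_map fE expr2 !derivM !derivXsubC /k; ring.
have ha : root h a by rewrite rootM root_XsubC eqxx.
have ka : k.[a] = 2%:R * g.[a].
  by rewrite /k hornerD !hornerM hornerXsubC subrr mul0r addr0 -polyC_natr hornerC.
have ka0 : k.[a] != 0 by rewrite ka mulf_neq0.
have co : coprimep h k.
  rewrite /h coprimepMl [coprimep _ k]coprimep_sym coprimep_XsubC ka0 /=.
  rewrite /k coprimep_addl_mul coprimepMr coprimep_XsubC ga.
  exact: sqfree_coprime_deriv.
have [y fa] : exists y, f.[L a] = pi * y.
  by apply: redP; rewrite red_horner fEh hornerM hornerXsubC subrr mul0r.
split=> [[c rE]|[c fc]].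
  have [/redP[c' yE]|y0] := eqVneq (red y) 0.
    by exists c'; rewrite fa yE; ring.
  by case: (resultant_simple_root pi_neq0 red_pi redP LK L1 rf_neq0 size_rf fEh gE co ha fa y0 rE).
have [b f'a] : exists b, f^`().[L a] = pi * b.
  by apply: redP; rewrite red_horner gE hornerM hornerXsubC subrr mul0r.
have f''a : red f^`()^`().[L a] = k.[a].
  rewrite red_horner -deriv_map gE derivM derivXsubC mul1r hornerD hornerM.
  by rewrite hornerXsubC subrr mul0r addr0.
(* Newton step for f': t cancels the first-order term of f' at a + pi t. The value of f changes
   there only by multiples of pi^2, as pi divides f'(a). *)
pose t := L (- red b / k.[a]).
have [e eE] : exists e, b + f^`()^`().[L a] * t = pi * e.
  apply: redP; rewrite rmorphD rmorphM /= f''a LK mulrC divfK //.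
  by rewrite subrr.
have [r1 fr] := horner_taylor2 f (L a) (pi * t).
have [r2 f'r] := horner_taylor2 f^`() (L a) (pi * t).
apply: (@resultant_common_root _ pi f f^`() (L a + pi * t) (c + b * t + r1 * t ^+ 2)
  (e + r2 * t ^+ 2)).
- rewrite -size_rf fE size_monicM ?monic_exp ?monicXsubC // expr2.
  rewrite size_monicM ?monicXsubC ?polyXsubC_eq0 // size_XsubC /=.
  by rewrite -size_poly_gt0 in g0; case: (size g) g0.
- rewrite ltnNge; apply: contraNN ka0 => /size1_polyC f'C.
  by rewrite -f''a f'C derivC horner0 rmorph0.
- by rewrite fr fc f'a; ring.
- rewrite f'r f'a.
  have -> : pi * b + f^`()^`().[L a] * (pi * t) = pi * (b + f^`()^`().[L a] * t) by ring.
  by rewrite eE; ring.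
Qed.

(** In each remaining case f and f' share a factor of degree at least 2 modulo pi: d^2 in
    characteristic 2, where its derivative is 0; d itself if deg d >= 2; (X - a)^2 at a root of
    multiplicity three or more; (X - a) e if a further square e^2 divides the cofactor. *)
Lemma resultant_deriv_other : ~~ sqfree (rp f) ->
  (2%:R != 0 :> F -> forall a g, rp f = ('X - a%:P) ^+ 2 * g -> sqfree g -> root g a) ->
  exists c, resultant f f^`() = pi ^+ 2 * c.
Proof.
move=> nsf no2; have common D : D %| rp f -> D %| (rp f)^`() -> (2 < size D)%N ->
    exists c, resultant f f^`() = pi ^+ 2 * c.
  by rewrite deriv_map; apply: resultant_common_divisor.
have [d [dm d2 d1]] : exists d, [/\ d \is monic, d ^+ 2 %| rp f & d != 1].
  apply: contrapT => nd; move/(sqfreeP rf_neq0): nsf; apply => d dm d2.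
  by apply/eqP/contraT => d1; case: nd; exists d.
have dd : d %| d ^+ 2 by rewrite expr2 dvdp_mulr.
have sd : (1 < size d)%N.
  rewrite ltn_neqAle size_poly_gt0 monic_neq0 // andbT eq_sym size_poly_eq1.
  by apply: contraNN d1 => /(monic_eqp dm (monic1 _)) ->.
have [two0|two0] := eqVneq (2%:R : F) 0.
  apply: (common (d ^+ 2)) => //.
    move/dvdpP: d2 => [g ->].
    have -> : (g * d ^+ 2)^`() = g^`() * d ^+ 2 + 2%:R * (g * d * d^`()).
      by rewrite expr2 !derivM; ring.
    by rewrite -polyC_natr two0 mul0r addr0 dvdp_mull.
  rewrite expr2 size_monicM ?monic_neq0 //; move: sd; case: (size d) => [|[|i]] // _.
  by rewrite !addnS.
have [sd2|sd2] := ltnP 2 (size d).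
  by apply: (common d) => //; [exact: dvdp_trans d2 | exact: sqr_dvd_deriv].
have [a dE] : exists a, d = 'X - a%:P.
  exists (- d`_0); apply/polyP => i; rewrite coefB coefX coefC.
  have s2 : size d = 2 by apply/eqP; rewrite eqn_leq sd2.
  case: i => [|[|i]] /=; rewrite ?sub0r ?opprK // ?subr0.
    by move/monicP: dm; rewrite lead_coefE s2.
  by rewrite oppr0 nth_default // s2.
rewrite {}dE {d dm d1 sd sd2 dd} in d2.
move/dvdpP: (d2) => [g]; rewrite mulrC => fE.
have g0 : g != 0 by apply: contraNneq rf_neq0 => g0; rewrite fE g0 mulr0.
have [sg|nsg] := boolP (sqfree g).
  have := no2 two0 a g fE sg; rewrite -dvdp_XsubCl => /dvdpP[g1 gE].
  apply: (common (('X - a%:P) ^+ 2)) => //.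
    rewrite fE gE; have -> : ('X - a%:P) ^+ 2 * (g1 * ('X - a%:P)) =
      ('X - a%:P) ^+ 2 * ('X - a%:P) * g1 by ring.
    rewrite expr2 !derivM !derivXsubC.
    apply/dvdpP; exists (3%:R * g1 + ('X - a%:P) * g1^`()); ring.
  by rewrite expr2 size_monicM ?monicXsubC ?polyXsubC_eq0 // size_XsubC.
have [e [em e2 e1]] : exists e, [/\ e \is monic, e ^+ 2 %| g & e != 1].
  apply: contrapT => nd; move/(sqfreeP g0): nsg; apply => e em e2.
  by apply/eqP/contraT => e1; case: nd; exists e.
have D2 : (('X - a%:P) * e) ^+ 2 %| rp f by rewrite fE exprMn dvdp_mul2l ?expf_neq0 ?polyXsubC_eq0.
apply: (common (('X - a%:P) * e)); last 1 first.
- rewrite size_monicM ?monicXsubC ?monic_neq0 // size_XsubC /= !ltnS.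
  rewrite ltn_neqAle size_poly_gt0 monic_neq0 // andbT eq_sym size_poly_eq1.
  by apply: contraNN e1 => /(monic_eqp em (monic1 _)) ->.
- by apply: dvdp_trans D2; rewrite expr2 dvdp_mulr.
- exact: sqr_dvd_deriv.
Qed.
End ResultantDeriv.

Lemma irreducible_divisor (F : fieldType) (d : {poly F}) : (1 < size d)%N ->
  exists c, [/\ c \is monic, irreducible_poly c & c %| d].
Proof.
move=> sd; have d0 : d != 0 by rewrite -size_poly_gt0 ltnW.
pose P k := `[< exists e : {poly F}, [/\ size e = k, (1 < k)%N & e %| d] >].
have exP : exists k, P k by exists (size d); apply/asboolP; exists d.
case: (ex_minnP exP) => k /asboolP[e [ek k1 ed]] kmin.
have e0 : e != 0 by rewrite -size_poly_gt0 ek ltnW.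
have le0 : (lead_coef e)^-1 != 0 by rewrite invr_eq0 lead_coef_eq0.
exists ((lead_coef e)^-1 *: e); split.
- by rewrite monicE lead_coefZ mulVf ?lead_coef_eq0.
- split; first by rewrite size_scale // ek.
  move=> q sq; rewrite dvdpZr // => qe; rewrite -dvdp_size_eqp ?dvdpZr // size_scale //.
  rewrite eqn_leq dvdp_leq // ek; apply: kmin; apply/asboolP; exists q; split=> //.
    rewrite ltn_neqAle eq_sym sq size_poly_gt0.
    by apply: contraNneq e0 => q0; move: qe; rewrite q0 dvd0p.
  exact: dvdp_trans ed.
- by rewrite dvdpZl.
Qed.

Lemma poly_sum_lt (R : nzSemiRingType) n (r : {poly R}) : (size r <= n)%N ->
  r = \sum_(j < n) r`_j *: 'X^j.
Proof.
move=> sr; rewrite -poly_def; apply/polyP => i; rewrite coef_poly.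
by case: ltnP => // le_ni; rewrite nth_default // (leq_trans sr).
Qed.

Lemma tofrac_inj (R : idomainType) : injective (@tofrac R).
Proof. by move=> x y /eqP; rewrite tofrac_eq => /eqP. Qed.

Lemma divmod_monic (R : idomainType) (f : {poly R}) : f \is monic -> forall g,
  exists q r, g = q * f + r /\ (size r < size f)%N.
Proof.
move=> fm g; exists (Pdiv.Ring.rdivp g f), (Pdiv.Ring.rmodp g f); split.
  exact: Pdiv.RingMonic.rdivp_eq.
by rewrite Pdiv.Ring.ltn_rmodp monic_neq0.
Qed.

(** * Orders and the Dedekind criterion *)

Section Integral.
Variables (Z : idomainType) (K : comAlgType {fraction Z}).

(** Determinant trick: b acts on the generators of O by a matrix C over Z, so det(b - C) kills all
    generators and hence 1. The characteristic polynomial of C is the monic equation. *)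
Lemma order_integral (O : set K) (b : K) : is_order O -> O b ->
  exists2 P : {poly Z}, P \is monic & \sum_(i < size P) tofrac P`_i *: b ^+ i = 0.
Proof.
move=> [one_in Oring [m [e Oe]] _] Ob.
pose iota : {rmorphism Z -> K} := GRing.RMorphism.clone _ _ (in_alg K \o @tofrac Z) _.
have ex i : exists c : 'I_m -> Z, b * e i = \sum_(j < m) tofrac (c j) *: e j.
  have Oi : O (e i).
    rewrite Oe; exists (fun j => (j == i)%:R) => //.
    rewrite (bigD1 i) //= eqxx rmorph1 scale1r big1 ?addr0 // => j /negPf->.
    by rewrite rmorph0 scale0r.
  have [_] := Oring _ _ Ob Oi; rewrite {1}Oe => -[c _ <-]; by exists c.
have [c cE] := choice ex.
pose C := \matrix_(i, j) c i j; exists (char_poly C); first exact: char_poly_monic.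
transitivity (map_poly iota (char_poly C)).[b].
  have size_le : (size (map_poly iota (char_poly C)) <= size (char_poly C))%N by apply: size_poly.
  rewrite (horner_coef_wide _ size_le); apply: eq_bigr => i _.
  by rewrite coef_map /= mulr_algl.
pose M : 'M[K]_m := b%:M - map_mx iota C.
have -> : (map_poly iota (char_poly C)).[b] = \det M.
  rewrite -horner_evalE -/(map_poly iota _) map_char_poly.
  rewrite /char_poly -det_map_mx /=; congr (\det _); apply/matrixP => i j.
  rewrite !mxE /= horner_evalE hornerD hornerN hornerC hornerMn hornerX //.
have Me : M *m (\col_i e i) = 0.
  apply/matrixP => i j; rewrite mulmxBl mul_scalar_mx !mxE cE.
  apply/eqP; rewrite subr_eq0; apply/eqP; apply: eq_bigr => k _.
  by rewrite !mxE /= mulr_algl.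
have det0 i : \det M * e i = 0.
  have := congr1 (fun A => (\adj M *m A) i 0) Me.
  by rewrite mulmxA mul_adj_mx mul_scalar_mx mulmx0 !mxE.
move: one_in; rewrite Oe => -[d _ d1].
rewrite -[LHS]mulr1 -d1 mulr_sumr big1 // => i _.
by rewrite -scalerAr det0 scaler0.
Qed.
End Integral.

Section Orders.
Variables (Z : idomainType) (pi : Z) (f : {poly Z}).
Hypotheses (pi_neq0 : pi != 0) (f_monic : f \is monic).
Variables (K : comAlgType {fraction Z}) (phi : {rmorphism {poly Z} -> K}).
Hypothesis phiZ : forall c g, phi (c%:P * g) = tofrac c *: phi g.
Hypothesis phi_modulus : phi f = 0.
Hypothesis phi_eq0 : forall g, phi g = 0 -> exists q, g = q * f.
Hypothesis phi_span : forall x, exists m g, tofrac pi ^+ m *: x = phi g.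

Let pi_frac : tofrac pi != 0 :> {fraction Z}.
Proof. by rewrite tofrac_eq0. Qed.

Lemma phi_coef n (r : {poly Z}) : (size r <= n)%N ->
  phi r = \sum_(j < n) tofrac r`_j *: phi 'X^j.
Proof.
move=> sr; rewrite {1}(poly_sum_lt sr) rmorph_sum; apply: eq_bigr => j _.
by rewrite -mul_polyC phiZ.
Qed.

(* A ring as soon as alpha is a root of a monic quadratic polynomial over the
   image of phi. *)
Definition order_ext (alpha : K) : set K :=
  [set x | exists u v, x = phi u + alpha * phi v]%classic.

Lemma order_extP (alpha : K) s t : alpha * alpha = phi s + alpha * phi t ->
  is_order (order_ext alpha).
Proof.
move=> aa; split.
- by exists 1, 0; rewrite rmorph1 rmorph0 mulr0 addr0.
- move=> _ _ [u [v ->]] [u' [v' ->]]; split.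
    by exists (u - u'), (v - v'); rewrite !rmorphB; ring.
  exists (u * u' + s * v * v'), (u * v' + v * u' + t * v * v').
  rewrite !rmorphD !rmorphM /=.
  transitivity (phi u * phi u' + alpha * (phi u * phi v' + phi v * phi u')
    + (alpha * alpha) * (phi v * phi v')); first by ring.
  by rewrite aa; ring.
- pose n := size f.
  pose b (i : 'I_(n + n)) : K :=
    match fintype.split i with inl j => phi 'X^j | inr j => alpha * phi 'X^j end.
  exists (n + n)%N, b; apply/seteqP; split=> [x [u [v ->]]|x [c _ <-]].
    have [q1 [r1 [-> s1]]] := divmod_monic f_monic u.
    have [q2 [r2 [-> s2]]] := divmod_monic f_monic v.
    exists (fun i => match fintype.split i with inl j => r1`_j | inr j => r2`_j end) => //.
    rewrite !rmorphD !rmorphM phi_modulus !mulr0 !add0r big_split_ord /=.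
    rewrite (phi_coef (ltnW s1)) (phi_coef (ltnW s2)) mulr_sumr.
    congr (_ + _); apply: eq_bigr => j _.
      by rewrite /b (unsplitK (inl j)).
    by rewrite /b (unsplitK (inr j)) scalerAr.
  rewrite big_split_ord /=; exists (\sum_(j < n) (c (lshift n j))%:P * 'X^j),
    (\sum_(j < n) (c (rshift n j))%:P * 'X^j).
  rewrite !rmorph_sum mulr_sumr; congr (_ + _); apply: eq_bigr => j _.
    by rewrite /b (unsplitK (inl j)) phiZ.
  by rewrite /b (unsplitK (inr j)) phiZ scalerAr.
- move=> x; have [m [g xE]] := phi_span x.
  exists 1%N, (fun=> phi g), (fun=> (tofrac pi ^+ m)^-1); split.
    by move=> _; exists g, 0; rewrite rmorph0 mulr0 addr0.
  by rewrite big_ord1 -xE scalerA mulVf ?scale1r // expf_neq0.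
Qed.

Variables (F : fieldType) (red : {rmorphism Z -> F}) (L : F -> Z).
Hypothesis red_pi : red pi = 0.
Hypothesis redP : forall x, red x = 0 -> exists y, x = pi * y.
Hypotheses (LK : cancel L red) (L0 : L 0 = 0).
Local Notation rp := (map_poly red).
Local Notation Lp := (map_poly L).

Let O : set K := [set x | exists g, x = phi g]%classic.

Let rf_monic : rp f \is monic := monic_map red f_monic.

Lemma image_is_order : is_order O.
Proof.
have -> : O = order_ext 0.
  apply/seteqP; split=> x /=; first by case=> g ->; exists g, 0; rewrite mul0r addr0.
  by case=> u [v ->]; exists u => //; rewrite mul0r addr0.
by apply: (@order_extP _ 0 0); rewrite !mul0r rmorph0 addr0.
Qed.

(** Dividing A f = (D A)^2 + pi B (D A) + pi^2 A C by pi^2 shows that a = D A / pi satisfies a^2 + B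
    a + A C = 0, so adjoining it gives an order. By maximality a already lies in O, hence f divides
    d A modulo pi, which forces d = 1 since f = d (d A) there. *)
Lemma maximal_no_sqr : is_maximal_order O -> no_sqr red pi f.
Proof.
move=> [_ Omax] d dm [D [A [B [C [DE fE]]]]].
pose a := (tofrac pi)^-1 *: phi (D * A).
have pia : tofrac pi *: a = phi (D * A) by rewrite /a scalerA mulfV // scale1r.
have aE : a * a = phi (- (C * A)) + a * phi (- B).
  have pi2 : tofrac pi ^+ 2 != 0 :> {fraction Z} by rewrite expf_neq0.
  apply: (scalerI pi2).
  have -> : tofrac pi ^+ 2 *: (a * a) = phi (D * A) * phi (D * A).
    by rewrite expr2 -scalerA scalerAl pia scalerAr pia.
  have -> : tofrac pi ^+ 2 *: (phi (- (C * A)) + a * phi (- B)) =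
      phi (pi%:P ^+ 2 * (- (C * A))) + phi (pi%:P * (D * A * (- B))).
    rewrite -polyC_exp !phiZ rmorphXn scalerDr; congr (_ + _).
    by rewrite expr2 -scalerA scalerAl pia -rmorphM.
  rewrite -rmorphM -rmorphD; apply/eqP; rewrite -subr_eq0 -rmorphB.
  have -> : D * A * (D * A) - (pi%:P ^+ 2 * - (C * A) + pi%:P * (D * A * - B)) = A * f.
    by rewrite fE; ring.
  by rewrite rmorphM phi_modulus mulr0.
have subO : (O `<=` order_ext a)%classic.
  by move=> x [g ->]; exists g, 0; rewrite rmorph0 mulr0 addr0.
have : order_ext a a by exists 0, 1; rewrite rmorph0 rmorph1 add0r mulr1.
rewrite (Omax _ (order_extP aE) subO) => -[g gE].
have /phi_eq0[q qE] : phi (D * A - pi%:P * g) = 0.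
  by rewrite rmorphB phiZ -gE pia subrr.
have rfE : rp f = d * (d * rp A).
  transitivity (rp (D * (D * A) + pi%:P * (D * B + pi%:P * C))).
    by congr (rp _); rewrite fE; ring.
  by rewrite rmorphD /= (rp_pi red_pi) addr0 !rmorphM /= DE.
have : rp f %| d * rp A.
  have := congr1 rp qE; rewrite rmorphB /= (rp_pi red_pi) subr0 !rmorphM /= DE => ->.
  by rewrite dvdp_mull.
rewrite {1}rfE; have dA0 : d * rp A != 0.
  by apply: contraNneq (monic_neq0 rf_monic) => dA0; rewrite rfE dA0 mulr0.
rewrite -{2}[d * rp A]mul1r dvdp_mul2r // dvdp1 size_poly_eq1 => d1.
by apply: monic_eqp; rewrite ?monic1.
Qed.

(** An element of a larger order outside O is scaled by a power of pi to b = g / pi, with g not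
    divisible by f modulo pi. Bezout for gcd(g, f) turns b into b2 = B / pi, where B lifts f / c for
    an irreducible c, and integrality of b2 then puts f into (pi, c)^2. *)
Lemma no_sqr_maximal : no_sqr red pi f -> is_maximal_order O.
Proof.
move=> nsq; split=> [|O' O'ord OO']; first exact: image_is_order.
apply/seteqP; split=> // x O'x; apply: contrapT => nOx.
have [_ O'ring _ _] := O'ord.
have O'B u v : O' u -> O' v -> O' (u - v) by move=> ? ?; case: (O'ring u v).
have O'M u v : O' u -> O' v -> O' (u * v) by move=> ? ?; case: (O'ring u v).
have O'phi g : O' (phi g) by apply: OO'; exists g.
have scale_phi c y : tofrac c *: y = phi c%:P * y.
  by rewrite -[c%:P]mulr1 phiZ rmorph1 -scalerAl mul1r.
have [b [g [bO' nOb pib]]] : exists b g, [/\ O' b, ~ O b & tofrac pi *: b = phi g].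
  have exm : exists m, `[< O (tofrac pi ^+ m *: x) >].
    by have [m [g gE]] := phi_span x; exists m; apply/asboolP; exists g.
  case: (ex_minnP exm) => -[|m] /asboolP[g gE] mmin.
    by case: nOx; exists g; rewrite -gE expr0 scale1r.
  exists (tofrac pi ^+ m *: x), g; split.
  - by rewrite -rmorphXn scale_phi; apply: O'M.
  - move=> Om; have /mmin : `[< O (tofrac pi ^+ m *: x) >] by apply/asboolP.
    by rewrite ltnn.
  - by rewrite scalerA -exprS.
have ndvd : ~~ (rp f %| rp g).
  apply/negP => /dvdpP[q gE]; apply: nOb.
  have /(rp_eq redP)[r rE] : rp g = rp (Lp q * f).
    by rewrite rmorphM /= (lift_polyK LK L0).
  exists r; apply: (scalerI pi_frac).
  by rewrite pib rE rmorphD rmorphM phi_modulus mulr0 add0r phiZ.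
set e := gcdp (rp g) (rp f).
have rf0 := monic_neq0 rf_monic.
have /dvdpP[d fde] : e %| rp f by apply: dvdp_gcdr.
have d0 : d != 0 by apply: contraNneq rf0 => d0; rewrite fde d0 mul0r.
have sd : (1 < size d)%N.
  rewrite ltn_neqAle size_poly_gt0 d0 andbT eq_sym; apply: contraNN ndvd => d1.
  apply: dvdp_trans (dvdp_gcdl (rp g) (rp f)); rewrite -/e fde.
  by rewrite -[X in _ %| X]mul1r dvdp_mul // dvdp1.
have [c [cm cirr /dvdpP[d1 dE]]] := irreducible_divisor sd.
have [u [v uv]] : exists u v, u * rp g + v * rp f = e.
  have [[u v] /=] := Bezoutp (rp g) (rp f); rewrite -/e => /eqpP[[c1 c2] /= /andP[c10 c20] cE].
  exists (c2^-1 * c1 *: u), (c2^-1 * c1 *: v).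
  by rewrite -!scalerAl -scalerDr -scalerA cE scalerA mulVf // scale1r.
pose Bb := d1 * e; pose B := Lp Bb.
have fcB : rp f = c * Bb by rewrite fde dE /Bb; ring.
(* Multiplying b by a Bezout coefficient times d1 and subtracting an element of O changes the
   numerator into a lift of d1 e = f / c. *)
have [b2 [b2O' pib2]] : exists b2, O' b2 /\ tofrac pi *: b2 = phi B.
  have [t tE] : exists t, Lp (d1 * u) * g = (B - Lp (d1 * v) * f) + pi%:P * t.
    apply: (rp_eq redP); rewrite rmorphB !rmorphM /= !(lift_polyK LK L0) /Bb -uv.
    by ring.
  exists (phi (Lp (d1 * u)) * b - phi t); split; first by apply/O'B/O'phi/O'M.
  rewrite scalerBr scalerAr pib -rmorphM tE rmorphD phiZ addrK rmorphB rmorphM.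
  by rewrite phi_modulus mulr0 subr0.
pose G := Lp c.
have [h hE] : exists h, f = G * B + pi%:P * h.
  by apply: (rp_eq redP); rewrite rmorphM /= !(lift_polyK LK L0).
have Gb2 : b2 * phi G = phi (- h).
  apply: (scalerI pi_frac); rewrite scalerAl pib2 -rmorphM -phiZ mulrN.
  by apply/eqP; rewrite rmorphN -addr_eq0 -rmorphD mulrC -hE phi_modulus.
have [P Pm Pb] := order_integral O'ord b2O'.
(* b2 is integral: clear the denominators phi r in its monic equation and
   reduce modulo c. *)
have intP r y : c %| rp r -> b2 * phi r = phi y -> c %| rp y.
  move=> cr ry; apply: contraT => ncy.
  have co : coprimep c (rp y) by rewrite irreducible_poly_coprime.
  pose N := (size P).-1.
  have sP : size P = N.+1 by rewrite prednK // size_poly_gt0 monic_neq0.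
  pose Y := \sum_(i < N.+1) (P`_i)%:P * (y ^+ i * r ^+ (N - i)).
  have /phi_eq0[q qE] : phi Y = 0.
    rewrite -[RHS](mul0r (phi r ^+ N)) -Pb sP mulr_suml /Y rmorph_sum.
    apply: eq_bigr => i _; rewrite phiZ -scalerAl; congr (_ *: _).
    rewrite rmorphM !rmorphXn -ry exprMn -mulrA -exprD subnKC //.
    by rewrite -ltnS ltn_ord.
  have : c %| rp Y by rewrite qE rmorphM /= dvdp_mull // fcB dvdp_mulr.
  rewrite /Y big_ord_recr /= subnn expr0 mulr1 rmorphD /= dvdp_addr; last first.
    rewrite rmorph_sum; apply: (big_ind (fun p => c %| p)); rewrite ?dvdp0 //.
      by move=> ? ? ? ?; apply: dvdp_add.
    move=> i _; rewrite !rmorphM rmorphXn /= -(prednK (_ : 0 < N - i)%N) ?subn_gt0 //.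
    by rewrite exprS !mulrA dvdp_mulr // dvdp_mull.
  have -> : P`_N = 1 by move/monicP: Pm; rewrite lead_coefE sP.
  rewrite mul1r rmorphXn /= => cyN.
  have := coprimep_expr N co; rewrite irreducible_poly_coprime //.
  by rewrite cyN.
(* b2 is both B / pi and -h / G; c divides both denominators modulo pi, so it divides both
   numerators, and f = G B + pi h lies in (pi, c)^2. *)
have cB : c %| rp B.
  apply: (intP pi%:P); first by rewrite map_polyC /= red_pi dvdp0.
  by rewrite mulrC -scale_phi.
have ch : c %| rp h.
  by rewrite -dvdpNr -rmorphN; apply: (intP G) => //; rewrite (lift_polyK LK L0).
have c1 : c = 1.
  apply: nsq => //.
  have /dvdpP[q1 /= q1E] := cB; have /dvdpP[q2 q2E] := ch.
  have /(rp_eq redP)[B1 BE] : rp B = rp (G * Lp q1).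
    by rewrite q1E rmorphM /= !(lift_polyK LK L0) mulrC.
  have /(rp_eq redP)[h1 h1E] : rp h = rp (G * Lp q2).
    by rewrite q2E rmorphM /= !(lift_polyK LK L0) mulrC.
  exists G, (Lp q1), (B1 + Lp q2), h1; split; first exact: lift_polyK.
  by rewrite hE h1E BE; ring.
by have [+ _] := cirr; rewrite c1 size_poly1.
Qed.
End Orders.

(** * The quotient Frac(Z)[x]/(f) *)

Section Quotient.
Variables (Z : idomainType) (F : fieldType) (red : {rmorphism Z -> F}).
Variables (pi : Z) (L : F -> Z).
Hypotheses (pi_neq0 : pi != 0) (red_pi : red pi = 0).
Hypothesis redP : forall x, red x = 0 -> exists y, x = pi * y.
Hypotheses (LK : cancel L red) (L0 : L 0 = 0).
Hypothesis fracP : forall x : {fraction Z}, exists m a, tofrac pi ^+ m * x = tofrac a.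
Variable f : {poly Z}.
Hypotheses (f_monic : f \is monic) (f_size : (1 < size f)%N).
Let fq := map_poly (@tofrac Z) f.
Let K : comAlgType {fraction Z} := {poly %/ fq}.

Let phi : {rmorphism {poly Z} -> K} :=
  GRing.RMorphism.clone _ _ (in_qpoly fq \o map_poly (@tofrac Z)) _.

Let size_fq : size fq = size f.
Proof. by rewrite size_map_inj_poly ?rmorph0 //; exact: tofrac_inj. Qed.

(** The quotient type passes its modulus through [mk_monic], which substitutes a default unless the
    modulus is monic of positive degree. *)
Let mk_monic_fq : mk_monic fq = fq.
Proof. by rewrite /mk_monic size_fq f_size monic_map. Qed.

Let phiZ c g : phi (c%:P * g) = tofrac c *: phi g.
Proof. by rewrite /= mul_polyC map_polyZ linearZ. Qed.

Let phi_modulus : phi f = 0.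
Proof.
apply: val_inj; rewrite /= mk_monic_fq -/fq.
by rewrite -[X in Pdiv.Ring.rmodp X _]mul1r Pdiv.RingMonic.rmodp_mull // monic_map.
Qed.

Let phi_eq0 g : phi g = 0 -> exists q, g = q * f.
Proof.
have [q [r [-> sr]]] := divmod_monic f_monic g.
rewrite rmorphD rmorphM phi_modulus mulr0 add0r => /(congr1 val) /=.
rewrite mk_monic_fq Pdiv.Ring.rmodp_small; last first.
  by rewrite size_fq size_map_inj_poly ?rmorph0 //; exact: tofrac_inj.
move=> r0; exists q; suff -> : r = 0 by rewrite addr0.
by apply: (map_inj_poly (@tofrac_inj Z) (rmorph0 _)); rewrite r0 rmorph0.
Qed.

Let poly_fracP (h : {poly {fraction Z}}) :
  exists m g, tofrac pi ^+ m *: h = map_poly (@tofrac Z) g.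
Proof.
elim/poly_ind: h => [|h c [m [g hE]]]; first by exists 0%N, 0; rewrite scaler0 rmorph0.
have [k [a cE]] := fracP c.
exists (m + k)%N, (pi ^+ k *: g * 'X + (pi ^+ m * a)%:P).
rewrite rmorphD rmorphM /= map_polyZ map_polyX map_polyC /= rmorphM !rmorphXn /=.
rewrite -cE -hE scalerDr exprD -!scalerAl scalerA [_ ^+ k * _]mulrC.
congr (_ + _); first by rewrite mulrC.
by rewrite scale_polyC -mulrA [c * _]mulrC.
Qed.

Let phi_span x : exists m g, tofrac pi ^+ m *: x = phi g.
Proof.
have [m [g xE]] := poly_fracP (val x).
exists m, g; apply: val_inj; rewrite /= -xE.
by rewrite Pdiv.Ring.rmodp_small // (leq_ltn_trans (size_scale_leq _ _)) // size_mk_monic.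
Qed.

Theorem monogenic_maximal :
  is_maximal_order (@monogenic_order Z f) <-> no_sqr red pi f.
Proof.
have -> : @monogenic_order Z f = [set x | exists g, x = phi g]%classic.
  by apply/seteqP; split=> x /= [g]; [move=> _ <-; exists g | move=> ->; exists g].
split.
  exact: (maximal_no_sqr pi_neq0 f_monic phiZ phi_modulus phi_eq0 phi_span red_pi).
exact: (no_sqr_maximal pi_neq0 f_monic phiZ phi_modulus phi_eq0 phi_span red_pi redP LK L0).
Qed.
End Quotient.

Lemma frac_numden (R : idomainType) (x : {fraction R}) :
  exists a b, b != 0 /\ tofrac b * x = tofrac a.
Proof.
elim/quotW: x => r; exists (frac r).1, (frac r).2; split; first exact: denom_ratioP.
unlock FracField.tofrac; rewrite -[LHS]FracField.pi_mul.
apply/eqmodP => /=; rewrite FracField.equivfE /FracField.mulf.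
by rewrite !numden_Ratio ?(oner_neq0, mul1r, mulr1, denom_ratioP) // mulrC.
Qed.

(** * Z_p and its residue field *)

Section PadicResidue.
Variables (p : nat) (p_pr : prime p).
Local Notation Zp := (padic_int p_pr).
Local Notation F := 'F_p.
Implicit Types x y z : Zp.

Lemma padic_natr m : m%:R = padic_nat p_pr m :> Zp.
Proof.
elim: m => [//|m IHm]; rewrite -natr1 IHm; apply: padic_eq => k /=.
by rewrite modnDm addn1.
Qed.

Definition padic_red x : F := (padic_res x 1)%:R.

Lemma padic_red_is_zmod : zmod_morphism padic_red.
Proof.
have redD x y : padic_red (x + y) = padic_red x + padic_red y.
  by rewrite /padic_red /= expn1 Fp_nat_mod // natrD.
by move=> x y; apply/eqP; rewrite eq_sym subr_eq -redD subrK.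
Qed.

Lemma padic_red_is_monoid : monoid_morphism padic_red.
Proof.
split=> [|x y]; last by rewrite /padic_red /= expn1 Fp_nat_mod // natrM.
by rewrite /padic_red /= expn1 Fp_nat_mod.
Qed.

HB.instance Definition _ := GRing.isZmodMorphism.Build Zp F padic_red padic_red_is_zmod.
HB.instance Definition _ := GRing.isMonoidMorphism.Build Zp F padic_red padic_red_is_monoid.

Definition padic_lift (a : F) : Zp := (val a)%:R.

Lemma padic_liftK : cancel padic_lift padic_red.
Proof. by move=> a; rewrite /padic_lift rmorph_nat natr_Zp. Qed.

Lemma padic_lift0 : padic_lift 0 = 0. Proof. by []. Qed.

Lemma padic_lift1 : padic_lift 1 = 1. Proof. by []. Qed.

Lemma padic_red_p : padic_red p%:R = 0.
Proof. by rewrite rmorph_nat; apply/eqP; rewrite -(dvdn_pcharf (pchar_Fp p_pr)). Qed.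

Lemma padic_p_neq0 : p%:R != 0 :> Zp.
Proof.
apply/eqP; rewrite padic_natr => /(congr1 (fun x => padic_res x 2)) /=.
rewrite mod0n modn_small; first by move=> p0; have := prime_gt0 p_pr; rewrite p0.
by rewrite -{1}[p]expn1 ltn_exp2l // prime_gt1.
Qed.

(** Division by p shifts the residues: the k-th residue of y is the (k + 1)-st residue of x divided
    by p. *)
Lemma padic_red_eq0 x : padic_red x = 0 -> exists y, x = p%:R * y.
Proof.
move=> /eqP; rewrite /padic_red -(dvdn_pcharf (pchar_Fp p_pr)) => px1.
have px k : (p %| padic_res x k.+1)%N.
  move: px1; rewrite -(padic_res_mod x (ltn0Sn k)) expn1 => px1.
  by rewrite (divn_eq (padic_res x k.+1) p) dvdn_add // dvdn_mull.
have yP k : (padic_res x k.+1 %/ p = (padic_res x k.+2 %/ p) %% p ^ k)%N.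
  by rewrite modn_divl -expnSr -padic_resP.
exists (PadicInt p_pr yP); rewrite padic_natr; apply: padic_eq => k /=.
by rewrite modnMml mulnC divnK // [LHS]padic_resP.
Qed.

Lemma padic_res_pX k z : padic_res (p%:R ^+ k * z) k = 0%N.
Proof. by rewrite -natrX padic_natr /= modnn mul0n mod0n. Qed.

Lemma padic_res_addpX x k z : padic_res (x + p%:R ^+ k * z) k = padic_res x k.
Proof.
have -> : padic_res (x + p%:R ^+ k * z) k =
  ((padic_res x k + padic_res (p%:R ^+ k * z)%R k) %% p ^ k)%N by [].
by rewrite padic_res_pX addn0 padic_res_small.
Qed.

(** The inverse is the geometric series; its residue modulo p^k is that of the k-th partial sum,
    since later terms are multiples of p^k. *)
Lemma padic_inv1B w : exists y, (1 - p%:R * w) * y = 1.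
Proof.
pose s k : Zp := \sum_(j < k) (p%:R * w) ^+ j.
have sS k : padic_res (s k.+1) k = padic_res (s k) k.
  have -> : s k.+1 = s k + p%:R ^+ k * w ^+ k by rewrite -exprMn /s big_ord_recr.
  exact: padic_res_addpX.
have yP k : padic_res (s k) k = (padic_res (s k.+1) k.+1 %% p ^ k)%N.
  by rewrite -padic_resP sS.
exists (PadicInt p_pr yP); apply: padic_eq => k.
transitivity (padic_res ((1 - p%:R * w) * s k) k); first by [].
rewrite -[RHS](padic_res_addpX _ k (- w ^+ k)) mulrN -exprMn.
by congr (padic_res _ k); rewrite -opprB mulNr -subrX1 opprB.
Qed.

Lemma padic_unit_red x : padic_red x != 0 -> exists y, y * x = 1.
Proof.
move=> x0; pose v := padic_lift (padic_red x)^-1.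
have /padic_red_eq0[w wE] : padic_red (1 - v * x) = 0.
  by rewrite rmorphB rmorph1 rmorphM /= padic_liftK mulVf // subrr.
have [y yE] := padic_inv1B w; exists (y * v).
have vx : v * x = 1 - p%:R * w by rewrite -wE opprB addrC subrK.
by rewrite -mulrA vx mulrC.
Qed.

Lemma padic_factor x : x != 0 -> exists m u, padic_red u != 0 /\ x = p%:R ^+ m * u.
Proof.
move=> /padic_neq0[k]; elim: k x => [|k IHk] x.
  by rewrite padic_resP expn0 modn1.
have [/padic_red_eq0[y ->] yk|x0 _] := eqVneq (padic_red x) 0; last first.
  by exists 0%N, x; rewrite expr0 mul1r.
have [|m [u [u0 ->]]] := IHk y; last by exists m.+1, u; rewrite exprS mulrA.
apply: contraNneq yk => yk; rewrite padic_natr /= modnMml -/(dvdn _ _).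
by rewrite expnS dvdn_pmul2l ?prime_gt0 // /dvdn -padic_resP yk.
Qed.

(** A denominator is a power of p times a unit, and the unit can be moved to the numerator. *)
Lemma padic_fracP (x : {fraction Zp}) : exists m a, tofrac p%:R ^+ m * x = tofrac a.
Proof.
have [a [b [b0 ab]]] := frac_numden x; have [m [u [u0 bE]]] := padic_factor b0.
have [v vu] := padic_unit_red u0; exists m, (v * a).
rewrite tofracM -ab bE tofracM tofracXn -mulrA mulrCA.
by rewrite [tofrac v * _]mulrA -tofracM vu tofrac1 mul1r.
Qed.

End PadicResidue.

(** * Haar measure and p-adic digits *)

Section RowPolys.
Variables (n : nat).

Definition row_poly (A : nzRingType) (t : 'rV[A]_n) : {poly A} :=
  \sum_(i < n) t 0 i *: 'X^(n - i.+1).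

(** [monic_of_row] lists the coefficients from the top degree down, [rVpoly] from the constant term
    up. *)
Definition rev_row (T : Type) (t : 'rV[T]_n) : 'rV[T]_n := \row_i t 0 (rev_ord i).

Lemma rev_rowK (T : Type) : involutive (@rev_row T).
Proof. by move=> t; apply/rowP => i; rewrite !mxE rev_ordK. Qed.

Lemma row_polyE (A : nzRingType) (t : 'rV[A]_n) : row_poly t = rVpoly (rev_row t).
Proof.
rewrite /rVpoly poly_def /row_poly (reindex_inj rev_ord_inj) /=.
apply: eq_bigr => i _; rewrite valK mxE; congr (_ *: 'X^_).
by have := ltn_ord i; lia.
Qed.

Lemma monic_of_rowE (Z : idomainType) (t : 'rV[Z]_n) :
  monic_of_row t = 'X^n + rVpoly (rev_row t).
Proof. by rewrite -row_polyE. Qed.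

Lemma size_monic_of_row (Z : idomainType) (t : 'rV[Z]_n) : size (monic_of_row t) = n.+1.
Proof.
by rewrite monic_of_rowE size_polyDl ?size_polyXn // ltnS size_poly.
Qed.

Lemma monic_of_row_monic (Z : idomainType) (t : 'rV[Z]_n) : monic_of_row t \is monic.
Proof.
rewrite monic_of_rowE monicE lead_coefDl ?lead_coefXn //.
by rewrite size_polyXn ltnS size_poly.
Qed.

Variable F : finFieldType.

Lemma monic_of_row_monics (t : 'rV[F]_n) : monic_of_row t \in monics F n.
Proof. by rewrite mem_monics monic_of_row_monic size_monic_of_row eqxx. Qed.

Lemma sum_monic_of_row (R : nmodType) (G : {poly F} -> R) :
  \sum_(t : 'rV[F]_n) G (monic_of_row t) = \sum_(f <- monics F n) G f.
Proof.
rewrite big_image /= (reindex_inj (inv_inj (@rev_rowK F))) /=.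
by apply: eq_bigr => t _; rewrite monic_of_rowE rev_rowK.
Qed.

Lemma sum_row_poly (R : nmodType) (G : {poly F} -> R) :
  \sum_(t : 'rV[F]_n) G (row_poly t) = \sum_(f <- polys F n) G f.
Proof.
rewrite big_image /= (reindex_inj (inv_inj (@rev_rowK F))) /=.
by apply: eq_bigr => t _; rewrite row_polyE rev_rowK.
Qed.
End RowPolys.

Section HaarDigits.
Variables (R : realType) (p : nat) (p_pr : prime p) (n : nat).
Local Notation Zp := (padic_int p_pr).
Local Notation F := 'F_p.
Local Notation V := 'rV[Zp]_n.
Local Notation red := (@padic_red p p_pr).
Local Notation L := (@padic_lift p p_pr).
Local Notation D := ('rV[F]_n * 'rV[F]_n)%type.

Lemma padic_res_eq2 (x y : Zp) : padic_res y 2 = padic_res x 2 ->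
  exists z, y = x + p%:R ^+ 2 * z.
Proof.
move=> xy.
have d2 : padic_res (y - x) 2 = 0%N.
  have : padic_res y 2 = ((padic_res x 2 + padic_res (y - x)%R 2) %% p ^ 2)%N.
    by rewrite -[in LHS](subrK x y) addrC.
  rewrite xy -[in LHS](padic_res_small x) => /eqP.
  rewrite -{1}[padic_res x 2]addn0 eqn_modDl mod0n eq_sym.
  by rewrite padic_res_small => /eqP.
have [w wE] : exists w, y - x = p%:R * w.
  by apply: padic_red_eq0; rewrite /padic_red -(padic_res_mod _ (leqnSn 1)) d2 mod0n.
have [z zE] : exists z, w = p%:R * z.
  apply: padic_red_eq0; apply/eqP; rewrite /padic_red -(dvdn_pcharf (pchar_Fp p_pr)).
  move: d2; rewrite wE padic_natr /= modnMml => /eqP; rewrite -/(dvdn _ _).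
  rewrite expnS dvdn_pmul2l ?prime_gt0 // => pw.
  by rewrite -(padic_res_mod w (leqnSn 1)) /dvdn modn_mod; move: pw; rewrite /dvdn !expn1 => /eqP->.
by exists z; rewrite expr2 -mulrA -zE -wE addrC subrK.
Qed.

Definition digit_rep (t : D) : V := map_mx L t.1 + p%:R *: map_mx L t.2.

(** The cosets of p^2 Z_p^n, indexed by the first two digits of all coordinates. *)
Definition digit_coset (t : D) : set V := [set a | exists z, a = digit_rep t + p%:R ^+ 2 *: z].

Lemma digit_coset_cover a : exists t, digit_coset t a.
Proof.
have [b bE] : exists b, a = map_mx L (map_mx red a) + p%:R *: b.
  have [b bE] : exists b, a - map_mx L (map_mx red a) = p%:R *: b.
    apply: (rm_eq0 (@padic_red_eq0 p p_pr)).
    by rewrite map_mxB (lift_mxK (@padic_liftK p p_pr)) subrr.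
  by exists b; rewrite -bE addrC subrK.
have [c cE] : exists c, b = map_mx L (map_mx red b) + p%:R *: c.
  have [c cE] : exists c, b - map_mx L (map_mx red b) = p%:R *: c.
    apply: (rm_eq0 (@padic_red_eq0 p p_pr)).
    by rewrite map_mxB (lift_mxK (@padic_liftK p p_pr)) subrr.
  by exists c; rewrite -cE addrC subrK.
exists (map_mx red a, map_mx red b), c; rewrite /digit_rep /=.
by rewrite {1}bE {1}cE scalerDr scalerA -expr2 addrA.
Qed.

Lemma digit_coset_uniq a t t' : digit_coset t a -> digit_coset t' a -> t = t'.
Proof.
case: t t' => t0 t1 [t0' t1'] [z aE] [z' aE'].
have red_rep s0 s1 w : map_mx red (digit_rep (s0, s1) + p%:R ^+ 2 *: w) = s0.
  rewrite !map_mxD !map_mxZ rmorphXn /= padic_red_p expr0n /= !scale0r !addr0.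
  exact: (lift_mxK (@padic_liftK p p_pr)).
have t00 : t0 = t0' by rewrite -(red_rep t0 t1 z) -aE aE' red_rep.
rewrite -{}t00 in aE' *; congr (_, _).
have : p%:R *: (map_mx L t1 + p%:R *: z) = p%:R *: (map_mx L t1' + p%:R *: z') :> V.
  apply: (addrI (map_mx L t0)); rewrite !scalerDr !scalerA -expr2 !addrA.
  by rewrite -[LHS]aE aE'.
move=> pE; have : map_mx L t1 + p%:R *: z = map_mx L t1' + p%:R *: z'.
  apply/rowP => j; have /rowP/(_ j) := pE; rewrite mxE [in RHS]mxE.
  exact/mulfI/padic_p_neq0.
move/(congr1 (map_mx red)).
by rewrite !map_mxD !map_mxZ /= padic_red_p !scale0r !addr0 !(lift_mxK (@padic_liftK p p_pr)).
Qed.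

Lemma digit_coset_open t : open (digit_coset t).
Proof.
rewrite openE => a [z aE]; exists (fun i j => [set y | padic_res y 2 = padic_res (a i j) 2]).
  move=> i j; apply: open_nbhs_nbhs; split=> //.
  by move=> x /= xa; exists 2%N => y; rewrite xa.
move=> b /= ab.
have [w bE] : exists w : V, b = a + p%:R ^+ 2 *: w.
  have ex j : exists w, b 0 j = a 0 j + p%:R ^+ 2 * w by exact: padic_res_eq2.
  have [w wE] := choice ex; exists (\row_j w j); apply/rowP => j.
  by rewrite !mxE wE.
by exists (z + w); rewrite bE aE scalerDr addrA.
Qed.

Lemma digit_coset_measurable t : measurable (digit_coset t : set (borelType V)).
Proof. by apply: sub_sigma_algebra; exact: digit_coset_open. Qed.

Variable mu : probability (borelType V) R.
Hypothesis mu_haar : is_haar mu.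

Lemma haar_digit_coset t : mu (digit_coset t) = mu (digit_coset (0, 0)).
Proof.
rewrite -(mu_haar (digit_rep t) (digit_coset_measurable (0, 0))); congr (mu _).
have rep0 : digit_rep (0, 0) = 0.
  by apply/rowP => j; rewrite /digit_rep /= !mxE padic_lift0 mulr0 addr0.
apply/seteqP; split=> [a [z ->]|_ [b [z ->] <-]].
  by exists (p%:R ^+ 2 *: z) => //; exists z; rewrite rep0 add0r.
by exists z; rewrite rep0 add0r.
Qed.

Lemma haar_digit_set (P : pred D) :
  mu (\bigcup_(t in [set` P]) digit_coset t) = (\sum_(t | P t) mu (digit_coset (0, 0)%R))%E.
Proof.
rewrite measure_fin_bigcup.
- rewrite (bigfs _ (index_enum_uniq _)) => [|t _]; last by rewrite mem_index_enum.
  by apply: eq_fsbigr => t _; exact: haar_digit_coset.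
- exact: finite_finset.
- by move=> t t' _ _ [a [ta t'a]]; exact: digit_coset_uniq ta t'a.
- by move=> t _; exact: digit_coset_measurable.
Qed.

Lemma haar_digit_card (P : pred D) :
  fine (mu (\bigcup_(t in [set` P]) digit_coset t)) =
  (\sum_(t | P t) 1) / (p%:R ^+ n * p%:R ^+ n).
Proof.
have fin0 : mu (digit_coset (0, 0)) \is a fin_num.
  by apply: fin_num_measure; exact: digit_coset_measurable.
have fineE (Q : pred D) : fine (mu (\bigcup_(t in [set` Q]) digit_coset t)) =
    (\sum_(t | Q t) 1) * fine (mu (digit_coset (0, 0))).
  rewrite haar_digit_set -(fineK fin0) sumEFin /= mulr_suml.
  by apply: eq_bigr => t _; rewrite mul1r.
rewrite fineE; congr (_ * _).
(* The union of all cosets has mass 1, which determines their common mass as p^(-2n). *)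
have : fine (mu (\bigcup_(t in [set` (predT : pred D)]) digit_coset t)) = 1.
  rewrite (_ : \bigcup_(t in _) _ = setT) ?probability_setT //.
  by apply/seteqP; split=> // a _; have [t ta] := digit_coset_cover a; exists t.
rewrite fineE sumr_const card_prod card_mx card_Fp // mul1n natrM !natrX => c1.
have pn0 : p%:R ^+ n * p%:R ^+ n != 0 :> R.
  by rewrite mulf_neq0 // expf_neq0 // pnatr_eq0 -lt0n prime_gt0.
by apply: (mulfI pn0); rewrite c1 mulfV.
Qed.

(** An event decided by two digits is a finite union of cosets of equal mass, so its measure is a
    proportion of pairs of polynomials over F_p. *)
Lemma haar_digits (Q : {poly F} -> {poly F} -> bool) (A : set V) :
  (forall t a, digit_coset t a -> A a <-> Q (monic_of_row t.1) (row_poly t.2)) ->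
  fine (mu A) =
  (\sum_(f <- monics F n) \sum_(b <- polys F n | Q f b) 1) / (p%:R ^+ n * p%:R ^+ n).
Proof.
move=> AQ; pose P (t : D) := Q (monic_of_row t.1) (row_poly t.2).
have -> : A = \bigcup_(t in [set` P]) digit_coset t.
  apply/seteqP; split=> [a Aa|a [t /= Pt ta]]; last exact/(AQ _ _ ta).
  by have [t ta] := digit_coset_cover a; exists t => //=; apply/(AQ _ _ ta).
rewrite haar_digit_card; congr (_ / _).
rewrite -sum_monic_of_row -(pair_big_dep xpredT (fun t0 t1 => P (t0, t1)) (fun _ _ => 1)) /=.
apply: eq_bigr => t0 _; rewrite [RHS]big_mkcond -sum_row_poly [LHS]big_mkcond.
by apply: eq_bigr.
Qed.
End HaarDigits.

(** * Counting digits whose discriminant is not divisible by p^2 *)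

Section DoubleRootCount.
Variables (Z : idomainType) (F : finFieldType) (red : {rmorphism Z -> F}).
Variables (pi : Z) (L : F -> Z).
Hypotheses (pi_neq0 : pi != 0) (red_pi : red pi = 0).
Hypothesis redP : forall x, red x = 0 -> exists y, x = pi * y.
Hypotheses (LK : cancel L red) (L0 : L 0 = 0).
Local Notation Lp := (map_poly L).
Implicit Types (a : F) (f b g : {poly F}).

Definition double_root a f := [&& ('X - a%:P) ^+ 2 %| f,
  sqfree (f %/ ('X - a%:P) ^+ 2) & ~~ root (f %/ ('X - a%:P) ^+ 2) a].

Definition sqr_value a f b :=
  `[< exists c, (Lp f + pi%:P * Lp b).[L a] = pi ^+ 2 * c >].

(** The discriminant condition in terms of the two digits; [odd] stands for p <> 2, as in residue
    characteristic 2 a square factor modulo p already makes p^2 divide the discriminant. *)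
Definition disc_ok (odd : bool) f b :=
  sqfree f || odd && [exists a, double_root a f && ~~ sqr_value a f b].

Lemma double_rootM a g : double_root a (('X - a%:P) ^+ 2 * g) = sqfree g && ~~ root g a.
Proof. by rewrite /double_root dvdp_mulr // mulKp // expf_neq0 // polyXsubC_eq0. Qed.

Lemma double_rootP a f : double_root a f -> exists g,
  [/\ f = ('X - a%:P) ^+ 2 * g, sqfree g & ~~ root g a].
Proof.
case/and3P => Xf sg ga; exists (f %/ ('X - a%:P) ^+ 2); split=> //.
by rewrite mulrC divpK.
Qed.

Lemma double_root_nsqfree a f : f != 0 -> double_root a f -> ~~ sqfree f.
Proof.
move=> f0 /and3P[Xf _ _]; apply/negP => /(sqfreeP f0)/(_ _ (monicXsubC a) Xf).
by move/(congr1 (fun p => size (p : {poly F}))); rewrite size_XsubC size_poly1.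
Qed.

Lemma double_root_uniq a a' f : f != 0 -> double_root a f -> double_root a' f -> a = a'.
Proof.
move=> f0 /double_rootP[g [fE sg _]] /and3P[]; rewrite fE => Xf _ _.
have g0 : g != 0 by apply: contraNneq f0 => g0; rewrite fE g0 mulr0.
apply/eqP; apply: contraT => aa'.
have Xg : ('X - a'%:P) ^+ 2 %| g.
  rewrite -(@Gauss_dvdpr _ _ (('X - a%:P) ^+ 2)) // coprimep_expl // coprimep_expr //.
  by rewrite coprimep_XsubC root_XsubC.
have /(congr1 (fun p => size (p : {poly F}))) := sqfreeP g0 sg _ (monicXsubC a') Xg.
by rewrite size_XsubC size_poly1.
Qed.

Variable R : comNzRingType.
Local Notation q := (#|F|%:R : R).

Lemma sum_polys n : \sum_(b <- polys F n) 1 = q ^+ n.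
Proof. by rewrite big_const_seq count_predT size_polys iter_addr_0 natrX. Qed.

(** The value of [Lp f] at [L a] is pi w, so the excluded b are those with w + b(a) = 0 modulo pi, a
    fraction 1/q of all b. *)
Lemma count_not_sqr_value n a f : root f a ->
  \sum_(b <- polys F n.+1 | ~~ sqr_value a f b) 1 = q ^+ n.+1 - q ^+ n.
Proof.
move=> fa; apply/eqP; rewrite eq_sym subr_eq; apply/eqP.
rewrite -sum_polys [LHS](bigID (sqr_value a f)) /= addrC; congr (_ + _).
have red_horner g : red (Lp g).[L a] = g.[a].
  by rewrite -[a in RHS]LK -[in RHS](lift_polyK LK L0 g) horner_map.
have [w wE] : exists w, (Lp f).[L a] = pi * w.
  by apply: redP; rewrite red_horner; apply/rootP.
have s1 : (size (red w)%:P <= n.+1)%N.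
  by rewrite size_polyC; case: eqP.
have -> : q ^+ n = \sum_(b <- polys F n.+1 | 'X - a%:P %| (red w)%:P + b) 1.
  by rewrite (sum_polys_dvd R s1 (XsubC_monics a)) // subSS subn0.
apply: eq_bigl => b; rewrite dvdp_XsubCl rootE hornerD hornerC -red_horner -rmorphD.
apply/asboolP/eqP => [[c]|/redP[c cE]].
  rewrite hornerD hornerM hornerC wE -mulrDr expr2 -mulrA => /(mulfI pi_neq0) ->.
  by rewrite rmorphM /= red_pi mul0r.
by exists c; rewrite hornerD hornerM hornerC wE -mulrDr cE mulrA expr2.
Qed.

(** A double root a is unique and nonzero, and f = (X - a)^2 g with g of degree n counted by
    [count_sqf_nz]; each such f admits q ^ (n + 2) - q ^ (n + 1) second digits. *)
Lemma count_disc_ok n (odd : bool) :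
  \sum_(f <- monics F n.+2 | ~~ root f 0) \sum_(b <- polys F n.+2 | disc_ok odd f b) 1 =
  count_sqf F R n.+2 * q ^+ n.+2 +
  (\sum_(a : F | a != 0) count_sqf_nz R a n) * (q ^+ n.+2 - q ^+ n.+1) *+ odd.
Proof.
transitivity (\sum_(f <- monics F n.+2 | ~~ root f 0) (q ^+ n.+2 *+ sqfree f +
    (\sum_(a | double_root a f) (q ^+ n.+2 - q ^+ n.+1)) *+ odd)).
  rewrite big_seq_cond [RHS]big_seq_cond; apply: eq_bigr => f /andP[fn _].
  have f0 := monic_neq0 (monics_monic fn).
  rewrite /disc_ok; have [sf|nsf] /= := boolP (sqfree f).
    rewrite sum_polys big_pred0 ?mul0rn ?addr0 // => a.
    by apply/negP => /(double_root_nsqfree f0); rewrite sf.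
  rewrite mulr0n add0r; case: odd => /=; last by rewrite mulr0n big_pred0.
  have [a da|nd] := pickP (fun a => double_root a f); last first.
    rewrite mulr1n [RHS]big_pred0 // big_pred0 // => b.
    by apply/existsP => -[a]; rewrite nd.
  rewrite mulr1n [RHS](big_pred1 a) => [|a']; last first.
    by apply/idP/eqP => [da'|->//]; exact: double_root_uniq f0 da' da.
  have fa : root f a.
    have [g [-> _ _]] := double_rootP da.
    by rewrite expr2 -mulrA rootM root_XsubC eqxx.
  rewrite -(count_not_sqr_value _ fa); apply: eq_bigl => b.
  apply/existsP/idP => [[a' /andP[da']]|]; last by exists a; rewrite da.
  by rewrite (double_root_uniq f0 da' da).
rewrite big_split /= [X in _ + X]sumrMnl; congr (_ + _).
  rewrite /count_sqf mulr_suml big_mkcondr /=; apply: eq_bigr => f _.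
  by case: (sqfree f); rewrite ?mul1r.
congr (_ *+ _); rewrite (exchange_big_dep xpredT) //= mulr_suml [RHS]big_mkcond /=.
apply: eq_bigr => a _.
under eq_bigl => f do rewrite /double_root andbCA andbC.
have X2m : ('X - a%:P) ^+ 2 \in monics F 2.
  rewrite mem_monics monic_exp ?monicXsubC //= expr2.
  by rewrite size_monicM ?monicXsubC ?polyXsubC_eq0 // size_XsubC.
rewrite (big_monics_dvd _ _ _ X2m) /= !subSS subn0.
under eq_bigl => g do rewrite mulKp ?expf_neq0 ?polyXsubC_eq0 //.
case: ifP => a0; last first.
  rewrite big_pred0 // => g; rewrite expr2 -mulrA rootM root_XsubC eq_sym.
  by move/negbFE: a0 => ->.
rewrite /count_sqf_nz mulr_suml; apply: eq_big => [g|g _]; last by rewrite mul1r.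
rewrite expr2 !rootM !negb_or !root_XsubC eq_sym a0 /=.
by case: (root g 0); case: (root g a); case: (sqfree g).
Qed.
End DoubleRootCount.

(** * Closed forms *)

Section Numerics.
Variables (R : realFieldType) (F : finFieldType).
Local Notation q := (#|F|%:R : R).

Let q_ge2 : 2 <= q.
Proof. by rewrite ler_nat finNzRing_gt1. Qed.

Let q_gt0 : 0 < q. Proof. by apply: lt_le_trans q_ge2. Qed.
Let q_neq0 : q != 0. Proof. exact: lt0r_neq0. Qed.
Let q1_neq0 : q + 1 != 0. Proof. by apply: lt0r_neq0; rewrite addr_gt0. Qed.
Let qB1_gt0 : 0 < q - 1.
Proof. by rewrite subr_gt0; apply: lt_le_trans q_ge2; rewrite ltr1n. Qed.
Let poly_gt0 : 0 < q ^+ 2 + q + 1.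
Proof. by rewrite !addr_gt0 // exprn_gt0. Qed.

Lemma count_nz_gt0 n : 0 < count_nz F R n.+1.
Proof.
rewrite count_nzS exprS -{2}[q ^+ n]mul1r -mulrBl mulr_gt0 //.
by rewrite exprn_gt0.
Qed.

Lemma count_sqf_gt0 n : 0 < count_sqf F R n.+1.
Proof.
rewrite -(pmulr_rgt0 _ (_ : 0 < q + 1)) ?addr_gt0 // count_sqf_closed mulr_gt0 //.
rewrite subr_gt0; apply: (@le_lt_trans _ _ 1).
  by rewrite -signr_odd; case: (odd _); rewrite ?expr1 ?expr0 //; lra.
by rewrite exprn_egt1 // (lt_le_trans _ q_ge2) // ltr1n.
Qed.

Lemma count_sqf_ratio n : count_sqf F R n.+1 / count_nz F R n.+1 =
  q / (q + 1) * (1 - (- 1) ^+ n.+1 / q ^+ n.+1).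
Proof.
have -> : count_sqf F R n.+1 = (q - 1) * (q ^+ n.+1 - (- 1) ^+ n.+1) / (q + 1).
  by rewrite -count_sqf_closed mulrC mulKf.
have qn0 : q ^+ n != 0 by rewrite expf_neq0.
have qB0 := lt0r_neq0 qB1_gt0.
rewrite count_nzS exprS; set x := q ^+ n in qn0 *; set y := (- 1) ^+ n.+1.
have -> : q * x - x = (q - 1) * x by ring.
by field; rewrite qB0 q_neq0 qn0 q1_neq0.
Qed.

(** The main term c q^n solves the recurrence with right-hand side (q - 1) / (q + 1) q^n, that is c
    (1 + 1/q) = (q - 1) / (q + 1). Each step adds to the error at most (q - 1) / (q + 1) < 1, from
    the alternating term. *)
Lemma count_sqf_nz_error (a : F) n : a != 0 ->
  `|count_sqf_nz R a n - q * (q - 1) / (q + 1) ^+ 2 * q ^+ n| <= n.+1%:R.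
Proof.
move=> a0; have q1_gt0 : 0 < q + 1 by rewrite addr_gt0.
have q12_gt0 : 0 < (q + 1) ^+ 2 by rewrite exprn_gt0.
elim: n => [|n IHn].
  rewrite count_sqf_nz0 expr0 mulr1 ler_norml; apply/andP; split.
    have : q * (q - 1) / (q + 1) ^+ 2 <= 1.
      by rewrite ler_pdivrMr // mul1r; have := q_gt0; nra.
    by move: (_ / _) => c; lra.
  by rewrite lerBlDr lerDl divr_ge0 ?mulr_ge0 // ltW.
rewrite count_sqf_nzS //.
have -> : count_sqf F R n.+1 = (q - 1) / (q + 1) * (q ^+ n.+1 - (- 1) ^+ n.+1).
  by rewrite mulrAC -count_sqf_closed mulrC mulKf.
have -> : (q - 1) / (q + 1) * (q ^+ n.+1 - (- 1) ^+ n.+1) - count_sqf_nz R a n -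
    q * (q - 1) / (q + 1) ^+ 2 * q ^+ n.+1 =
    - ((q - 1) / (q + 1) * (- 1) ^+ n.+1) -
    (count_sqf_nz R a n - q * (q - 1) / (q + 1) ^+ 2 * q ^+ n).
  by rewrite exprS; field.
rewrite (le_trans (ler_normB _ _)) // normrN normrM normrX normrN1 expr1n mulr1.
rewrite -[n.+2]add1n natrD lerD // ger0_norm ?divr_ge0 ?ltW //.
by rewrite ltr_pdivrMr // mul1r; lra.
Qed.

(** The limit is q / (q + 1) + (q - 1)^2 / (q (q + 1)^2), the second summand collecting the main
    terms of the q - 1 nonzero roots. The numerator left over q ^ (n + 2) is at most (q - 1) (n + 1)
    + 1, which the constant 2 covers generously. *)
Lemma sqf_density_error n (x : R) :
  x = count_sqf F R n.+2 / count_nz F R n.+2 +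
      (\sum_(a : F | a != 0) count_sqf_nz R a n) / q ^+ n.+2 ->
  `|x - (1 - (3 * q - 1) / (q * (q + 1) ^+ 2))| <= 2 * (n.+2%:R / q ^+ n.+1).
Proof.
move=> ->; rewrite count_sqf_ratio.
have cardF : \sum_(a : F | a != 0) (1 : R) = q - 1.
  have := sumr_const (predT : pred F) (1 : R); rewrite -[#|_|]/#|F| => <-.
  by rewrite [in RHS](bigD1 0) //= addrAC subrr add0r.
pose c := q * (q - 1) / (q + 1) ^+ 2 * q ^+ n.
pose E := \sum_(a : F | a != 0) (count_sqf_nz R a n - c).
have EE : \sum_(a : F | a != 0) count_sqf_nz R a n = E + (q - 1) * c.
  rewrite /E sumrB -cardF mulr_suml.
  by under [X in _ - X]eq_bigr do rewrite -[c]mul1r; rewrite subrK.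
have Ele : `|E| <= (q - 1) * n.+1%:R.
  rewrite (le_trans (ler_norm_sum _ _ _)) // -cardF mulr_suml ler_sum // => a a0.
  by rewrite mul1r count_sqf_nz_error.
have qn0 : q ^+ n != 0 by rewrite expf_neq0.
have qn_gt0 : 0 < q ^+ n by rewrite exprn_gt0.
have qn1_gt0 : 0 < q ^+ n.+1 by rewrite exprn_gt0.
have qn2_gt0 : 0 < q ^+ n.+2 by rewrite exprn_gt0.
rewrite EE /c.
have -> : q / (q + 1) * (1 - (- 1) ^+ n.+2 / q ^+ n.+2) +
    (E + (q - 1) * (q * (q - 1) / (q + 1) ^+ 2 * q ^+ n)) / q ^+ n.+2 -
    (1 - (3 * q - 1) / (q * (q + 1) ^+ 2)) =
    (E - q / (q + 1) * (- 1) ^+ n.+2) / q ^+ n.+2.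
  have -> : q ^+ n.+2 = q ^+ n * q * q by rewrite !exprSr.
  set y := (- 1) ^+ _.
  by field; rewrite qn0 q_neq0 q1_neq0.
rewrite normrM normfV (gtr0_norm qn2_gt0) ler_pdivrMr //.
have -> : 2 * (n.+2%:R / q ^+ n.+1) * q ^+ n.+2 = 2 * n.+2%:R * q.
  by rewrite [q ^+ n.+2]exprSr; field; rewrite lt0r_neq0.
rewrite (le_trans (ler_normB _ _)) // normrM normrX normrN1 expr1n mulr1.
have h1 : `|q / (q + 1)| <= 1.
  have q1_gt0 : 0 < q + 1 by rewrite addr_gt0.
  by rewrite gtr0_norm ?divr_gt0 // ler_pdivrMr // mul1r lerDl.
have n0 : 0 <= n%:R :> R by rewrite ler0n.
have n1 : n.+1%:R = n%:R + 1 :> R by rewrite -natr1.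
have n2 : n.+2%:R = n%:R + 2 :> R by rewrite -addn2 natrD.
have qm0 : 0 <= q * n%:R by rewrite mulr_ge0 // ltW.
move: Ele h1; rewrite n1 n2; move: (`|E|) (`|_ / _|) => e r Ele re.
apply: (le_trans (lerD Ele re)); move: qm0 n0 q_gt0.
move: (n%:R) (q) => m Q; nra.
Qed.

(** The full series is 1 - (q - 1) / (q^3 - 1), and q^3 - 1 = (q - 1) (q^2 + q + 1). *)
Let geometric j : \sum_(k < j.+1) mobius_nz F R k / q ^+ (3 * k) =
  1 - 1 / (q ^+ 2 + q + 1) + 1 / ((q ^+ 2 + q + 1) * q ^+ (3 * j)).
Proof.
have p0 := lt0r_neq0 poly_gt0.
elim: j => [|j IHj].
  by rewrite big_ord1 mobius_nz0 muln0 expr0 divr1 mulr1 subrK.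
rewrite big_ord_recr /= IHj mobius_nzS mulnS addnC exprD.
have qj0 : q ^+ (3 * j) != 0 by rewrite expf_neq0.
by set x := q ^+ (3 * j) in qj0 *; field; rewrite qj0 q_neq0 p0.
Qed.

(** Lying in (p, d)^2 costs q^(-2k) in the first digit and q^(-k) in the second. Strictness of 2k <
    n keeps [count_nz] in positive degree, where the first ratio is exact. *)
Let max_term n k : (k.*2 < n)%N ->
  mobius_nz F R k * q ^+ (n - k) * count_nz F R (n - k.*2) / (count_nz F R n * q ^+ n) =
  mobius_nz F R k / q ^+ (3 * k).
Proof.
move=> lt_kn; have [m nE] : exists m, n = (m.+1 + k.*2)%N.
  by exists (n - k.*2).-1; rewrite prednK ?subn_gt0 // subnK // ltnW.
have -> : (n - k = m.+1 + k)%N by lia.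
have -> : (n - k.*2 = m.+1)%N by lia.
have n1 : n = (m + k.*2).+1 by lia.
have e2 : q ^+ k.*2 = q ^+ k ^+ 2 by rewrite -muln2 exprM.
have -> : q ^+ (3 * k) = q ^+ k ^+ 3 by rewrite mulnC exprM.
have -> : q ^+ n = q * q ^+ m * q ^+ k ^+ 2 by rewrite n1 exprS exprD e2 mulrA.
have -> : q ^+ (m.+1 + k) = q * q ^+ m * q ^+ k by rewrite exprD exprS.
have -> : count_nz F R n = (q - 1) * q ^+ m * q ^+ k ^+ 2.
  by rewrite n1 count_nzS exprS exprD e2; ring.
have -> : count_nz F R m.+1 = (q - 1) * q ^+ m by rewrite count_nzS exprS; ring.
have qm0 : q ^+ m != 0 by rewrite expf_neq0.
have qk0 : q ^+ k != 0 by rewrite expf_neq0.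
set x := q ^+ m in qm0 *; set y := q ^+ k in qk0 *.
have qB0 := lt0r_neq0 qB1_gt0.
by field; rewrite q_neq0 qm0 qk0 qB0.
Qed.

(** For n = 2j + 1 the sum is a truncated geometric series with tail of order q^(-3j - 2). For n =
    2j + 2 the last term has [count_nz] in degree 0, larger than the geometric pattern; this turns
    the error into -(q^2 + q) / (q^2 + q + 1) q^(-3j - 3). Both fit the exponent n + ceil(n/2) with
    constant 1. *)
Lemma max_density_error n (x : R) : (1 < n)%N ->
  x = (\sum_(k < n./2.+1) if (k.*2 <= n)%N then
         mobius_nz F R k * q ^+ (n - k) * count_nz F R (n - k.*2) else 0) /
      (count_nz F R n * q ^+ n) ->
  `|x - (1 - 1 / (q ^+ 2 + q + 1))| <= 1 / q ^+ (n + uphalf n).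
Proof.
move=> n1 ->; have p0 := lt0r_neq0 poly_gt0.
rewrite mulr_suml -[in uphalf n](odd_double_half n) -[n in (n + _)%N]odd_double_half.
case n_odd: (odd n).
  rewrite (eq_bigr (fun k : 'I_(n./2.+1) => mobius_nz F R k / q ^+ (3 * k))); last first.
    move=> k _; have kn : (k.*2 < n)%N.
      by rewrite -[X in (_ < X)%N]odd_double_half n_odd add1n ltnS leq_double -ltnS.
    by rewrite ltnW // max_term.
  rewrite geometric; set j := n./2.
  have -> : (true + j.*2 + uphalf (true + j.*2) = 3 * j + 2)%N.
    by rewrite add1n /= doubleK; lia.
  have qj_gt0 : 0 < q ^+ (3 * j) by rewrite exprn_gt0.
  have qj0 := lt0r_neq0 qj_gt0.
  rewrite addrC addKr exprD ger0_norm; last by rewrite divr_ge0 // ltW // mulr_gt0.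
  rewrite ler_pdivrMr ?mulr_gt0 // mulrAC mul1r ler_pdivlMr ?mulr_gt0 ?exprn_gt0 //.
  rewrite mul1r mulrC ler_pM2r //; have := q_gt0; lra.
have nE : n = (n./2).*2 by rewrite -[LHS]odd_double_half n_odd.
rewrite add0n; case jE: (n./2) => [|j]; first by move: n1; rewrite nE jE.
have {}nE : n = j.+1.*2 by rewrite nE jE.
rewrite big_ord_recr /= (eq_bigr (fun k : 'I_j.+1 => mobius_nz F R k / q ^+ (3 * k))); last first.
  move=> k _; have kn : (k.*2 < n)%N by rewrite nE ltn_double.
  by rewrite ltnW // max_term.
rewrite geometric nE leqnn subnn count_nz0 mulr1 mobius_nzS.
have -> : (j.+1.*2 + uphalf j.+1.*2 = 3 * j + 3)%N by rewrite uphalf_double; lia.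
have -> : (j.+1.*2 - j.+1 = j.+1)%N by lia.
have n2 : j.+1.*2 = (j + j).+2 by lia.
have -> : q ^+ (3 * j) = q ^+ j ^+ 3 by rewrite mulnC exprM.
have -> : q ^+ (3 * j + 3) = q ^+ j ^+ 3 * q ^+ 3 by rewrite exprD mulnC exprM.
have -> : q ^+ j.+1.*2 = q ^+ 2 * q ^+ j ^+ 2 by rewrite n2 !exprS exprD; ring.
have -> : q ^+ j.+1 = q * q ^+ j by rewrite exprS.
have -> : count_nz F R j.+1.*2 = (q - 1) * q * q ^+ j ^+ 2.
  by rewrite n2 count_nzS !exprS exprD; ring.
have y_gt0 : 0 < q ^+ j by rewrite exprn_gt0.
have y0 := lt0r_neq0 y_gt0; set y := q ^+ j in y_gt0 y0 *.
have qB0 := lt0r_neq0 qB1_gt0.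
have -> : 1 - 1 / (q ^+ 2 + q + 1) + 1 / ((q ^+ 2 + q + 1) * y ^+ 3) +
    (1 - q) * (q * y) / ((q - 1) * q * y ^+ 2 * (q ^+ 2 * y ^+ 2)) -
    (1 - 1 / (q ^+ 2 + q + 1)) =
    - ((q + 1) * q / (q ^+ 2 + q + 1) / (y ^+ 3 * q ^+ 3)).
  by field; rewrite q_neq0 y0 p0 qB0.
have q1_gt0 : 0 < q + 1 by rewrite addr_gt0.
have yq_gt0 : 0 < y ^+ 3 * q ^+ 3 by rewrite mulr_gt0 ?exprn_gt0.
rewrite normrN gtr0_norm; last by rewrite divr_gt0 // divr_gt0 // mulr_gt0.
rewrite ler_pM2r ?invr_gt0 // ler_pdivrMr // mul1r mulrDl mul1r -expr2.
by rewrite lerDl.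
Qed.
End Numerics.

(** * The two densities *)

Section Densities.
Variables (R : realType) (p : nat) (p_pr : prime p) (n : nat).
Hypothesis n_ge2 : (1 < n)%N.
Local Notation Zp := (padic_int p_pr).
Local Notation F := 'F_p.
Local Notation V := 'rV[Zp]_n.
Local Notation red := (@padic_red p p_pr).
Local Notation L := (@padic_lift p p_pr).
Local Notation rp := (map_poly red).
Local Notation Lp := (map_poly L).
Local Notation P := (p%:R%:P : {poly Zp}).

Let p_neq0 := padic_p_neq0 p_pr.
Let red_p := padic_red_p p_pr.
Let redP := @padic_red_eq0 p p_pr.
Let LK := @padic_liftK p p_pr.
Let L0 := padic_lift0 p_pr.
Let L1 := padic_lift1 p_pr.

Lemma monic_of_row_digits t (a : V) : digit_coset t a -> exists C,
  monic_of_row a = Lp (monic_of_row t.1) + P * Lp (row_poly t.2) + P ^+ 2 * C.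
Proof.
case=> z ->; exists (row_poly z); rewrite !monic_of_rowE !row_polyE.
apply/polyP => i; rewrite !coefD -polyC_exp !coefCM !coef_map_id0 // !coefD !coefXn.
rewrite !coef_rVpoly; case: insubP => [j _ <-|_].
  by rewrite (ltn_eqF (ltn_ord j)) !mxE !add0r.
by case: eqP; rewrite !addr0 ?L1 ?L0 !mulr0 !addr0.
Qed.

Lemma zp_dvdP (d x : Zp) : zp_dvd d x <-> exists c, x = d * c.
Proof. by split=> -[c ->]; exists c; rewrite mulrC. Qed.

Section Coset.
Variables (t : 'rV[F]_n * 'rV[F]_n) (a : V).
Hypothesis ta : digit_coset t a.
Let f : {poly F} := monic_of_row t.1.
Let b : {poly F} := row_poly t.2.

Let fa_monic := monic_of_row_monic a.

Let fa_size : (1 < size (monic_of_row a))%N.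
Proof. by rewrite size_monic_of_row ltnS ltnW. Qed.

Let rp_fa : rp (monic_of_row a) = f.
Proof.
have [C ->] := monic_of_row_digits ta.
by rewrite expr2 -mulrA !rmorphD /= !(rp_pi red_p) !addr0 (lift_polyK LK).
Qed.

Lemma unit_const_coset : V_unit_const p_pr n a <-> ~~ root f 0.
Proof.
have red0 : red (monic_of_row a)`_0 = f.[0].
  by rewrite horner_coef0 -rp_fa coef_map.
rewrite rootE -red0; split=> [nd|/eqP nd /zp_dvdP[c cE]].
  by apply/negP => /eqP/redP[c cE]; apply: nd; apply/zp_dvdP; exists c.
by apply: nd; rewrite cE rmorphM /= red_p mul0r.
Qed.

(** The part of f beyond the second digit is a multiple of p^2, which lies in every (p, d)^2. *)
Lemma maximal_coset : is_maximal_order (@monogenic_order Zp (monic_of_row a)) <->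
  `[< no_sqr red p%:R (Lp f + P * Lp b) >].
Proof.
rewrite (monogenic_maximal p_neq0 red_p redP LK L0 (@padic_fracP p p_pr) fa_monic fa_size).
have [C ->] := monic_of_row_digits ta.
have CI d : in_sqr red p%:R d (P ^+ 2 * C).
  by exists (Lp d), 0, 0, C; rewrite (lift_polyK LK) //; split => //; ring.
split=> [nsq|/asboolP nsq]; first (apply/asboolP) ; move=> d dm d_in; apply: nsq => //.
  exact (in_sqrD redP d_in (CI d)).
rewrite -[X in in_sqr _ _ _ X](addrK (P ^+ 2 * C)).
exact (in_sqrB redP d_in (CI d)).
Qed.

(** The sign in [poly_disc] does not affect divisibility, and the value at the lift of a double root
    is determined modulo p^2 by the two digits; the squarefree, double-root and remaining cases
    exhaust all f. *)
Lemma disc_coset : ~ zp_dvd (p%:R ^+ 2) (poly_disc (monic_of_row a)) <->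
  disc_ok p%:R L (p != 2) f b.
Proof.
have f0 : f != 0 by apply/monic_neq0/(monics_monic (monic_of_row_monics _)).
set g := monic_of_row a.
have -> : zp_dvd (p%:R ^+ 2) (poly_disc g) <-> exists c, resultant g g^`() = p%:R ^+ 2 * c.
  rewrite zp_dvdP /poly_disc; set s := 'C(_, _).
  split=> -[c cE]; exists ((- 1) ^+ s * c).
    by rewrite mulrCA -cE mulrA -expr2 sqrr_sign mul1r.
  by rewrite cE mulrCA.
have two0 : (2%:R != 0 :> F) = (p != 2).
  by rewrite -(dvdn_pcharf (pchar_Fp p_pr)) dvdn_prime2.
have [sf|nsf] := boolP (sqfree f).
  split=> [_|_ [c]]; first by rewrite /disc_ok sf.
  by apply: (resultant_deriv_sqfree red_p LK fa_monic); rewrite rp_fa.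
have valueE x : (exists c, g.[L x] = p%:R ^+ 2 * c) <-> sqr_value p%:R L x f b.
  have [C gE] := monic_of_row_digits ta; rewrite /g gE -/f -/b.
  rewrite hornerD -polyC_exp [(_%:P * C).[_]]hornerM hornerC.
  split=> [[c cE]|/asboolP[c cE]].
    by apply/asboolP; exists (c - C.[L x]); rewrite mulrBr -cE addrK.
  by exists (c + C.[L x]); rewrite cE mulrDr.
have doubleE x : p != 2 -> double_root x f ->
    (exists c, resultant g g^`() = p%:R ^+ 2 * c) <-> sqr_value p%:R L x f b.
  rewrite -two0 => two /double_rootP[h [fE sh hx]]; rewrite -valueE.
  have gE : rp g = ('X - x%:P) ^+ 2 * h by rewrite rp_fa.
  exact: (resultant_deriv_double p_neq0 red_p redP LK L1 fa_monic two gE sh hx).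
have [p2|p2] := boolP (p != 2); last first.
  split; last by rewrite /disc_ok (negPf nsf).
  case; apply: (resultant_deriv_other p_neq0 redP LK L1 fa_monic).
    by rewrite rp_fa.
  by rewrite two0 (negPf p2).
rewrite /disc_ok (negPf nsf) /=.
have [x dx|ndx] := pickP (fun x => double_root x f).
  rewrite (doubleE x p2 dx); split=> [/negP nv|/existsP[y /andP[dy]]].
    by apply/existsP; exists x; rewrite dx.
  by rewrite (double_root_uniq f0 dy dx) => /negP.
split=> [|/existsP[x]]; last by rewrite ndx.
case; apply: (resultant_deriv_other p_neq0 redP LK L1 fa_monic).
  by rewrite rp_fa.
move=> _ x h; rewrite rp_fa => fE sh; apply: contraT => hx.
by have := ndx x; rewrite fE double_rootM sh hx.
Qed.
End Coset.

Variable mu : probability (borelType V) R.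
Hypothesis mu_haar : is_haar mu.
Local Notation q := (p%:R : R).

Lemma density_digits (Q : {poly F} -> {poly F} -> bool) (A : set V) :
  (forall t a, digit_coset t a -> A a <-> Q (monic_of_row t.1) (row_poly t.2)) ->
  density mu (V_unit_const p_pr n) A =
  (\sum_(f <- monics F n | ~~ root f 0) \sum_(b <- polys F n | Q f b) 1) /
  (count_nz F R n * q ^+ n).
Proof.
move=> AQ; rewrite /density.
rewrite (haar_digits mu_haar (Q := fun f b => ~~ root f 0 && Q f b)); last first.
  move=> t a ta; rewrite /setI /=; split=> [[/(unit_const_coset ta)-> /(AQ _ _ ta)]//|].
  by case/andP => r /(AQ _ _ ta) Aa; split=> //; apply/(unit_const_coset ta).
rewrite (haar_digits mu_haar (Q := fun f _ => ~~ root f 0)); last first.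
  by move=> t a ta; exact: unit_const_coset.
have qn0 : q ^+ n != 0 by rewrite expf_neq0 // pnatr_eq0 -lt0n prime_gt0.
rewrite invf_div mulrA divfK ?mulf_neq0 //.
congr (_ / _).
  rewrite [RHS]big_mkcond; apply: eq_bigr => f _.
  by case: (root f 0) => //=; rewrite big_pred0.
rewrite /count_nz mulr_suml [RHS]big_mkcond; apply: eq_bigr => f _.
case: (root f 0) => /=; first by rewrite big_pred0.
by rewrite sum_polys card_Fp // mul1r.
Qed.
End Densities.

Section Formulas.
Variables (R : realType) (p : nat) (p_pr : prime p).
Local Notation F := 'F_p.
Local Notation q := (#|F|%:R : R).

Let q_neq0 : q != 0.
Proof. by rewrite card_Fp // pnatr_eq0 -lt0n prime_gt0. Qed.

Lemma P_sqf_formula n (mu : probability (borelType 'rV[padic_int p_pr]_n.+2) R) :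
  is_haar mu ->
  P_sqf mu (V_unit_const p_pr n.+2) = count_sqf F R n.+2 / count_nz F R n.+2 +
    (\sum_(a : F | a != 0) count_sqf_nz R a n) / q ^+ n.+2 *+ (p != 2).
Proof.
move=> mu_haar; rewrite /P_sqf.
rewrite (density_digits mu_haar (Q := disc_ok p%:R (@padic_lift p p_pr) (p != 2))); last first.
  by move=> t a ta; apply: disc_coset.
rewrite (count_disc_ok (padic_p_neq0 p_pr) (padic_red_p p_pr) (@padic_red_eq0 p p_pr)
  (@padic_liftK p p_pr) (padic_lift0 p_pr)).
have N0 := lt0r_neq0 (count_nz_gt0 R F n.+1).
have qn0 : q ^+ n.+2 != 0 by rewrite expf_neq0.
(* The number q ^ (n + 2) - q ^ (n + 1) of admissible second digits equals [count_nz] in degree n +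
   2 and cancels against the normalisation. *)
rewrite -[X in _ / (_ * X ^+ _)](congr1 (fun k => k%:R) (card_Fp p_pr)) -count_nzS mulrDl.
congr (_ + _); first by rewrite -mulf_div divff // mulr1.
by rewrite mulrnAl; congr (_ *+ _); rewrite [X in _ / X]mulrC -mulf_div divff // mulr1.
Qed.

Lemma P_max_formula n (mu : probability (borelType 'rV[padic_int p_pr]_n) R) :
  (1 < n)%N -> is_haar mu ->
  P_max mu (V_unit_const p_pr n) =
  (\sum_(k < n./2.+1) if (k.*2 <= n)%N then
     mobius_nz F R k * q ^+ (n - k) * count_nz F R (n - k.*2) else 0) /
  (count_nz F R n * q ^+ n).
Proof.
move=> n_ge2 mu_haar; rewrite /P_max.
rewrite (density_digits mu_haar (Q := fun f b => `[< no_sqr (@padic_red p p_pr) p%:R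
  (map_poly (@padic_lift p p_pr) f + p%:R%:P * map_poly (@padic_lift p p_pr) b) >])); last first.
  by move=> t a ta; apply: maximal_coset.
have nK : (n < n./2.+1.*2)%N by rewrite -{1}[n]odd_double_half doubleS; case: (odd n); lia.
rewrite (count_no_sqr (padic_p_neq0 p_pr) (padic_red_p p_pr) (@padic_red_eq0 p p_pr)
  (@padic_liftK p p_pr) (padic_lift0 p_pr) (padic_lift1 p_pr) R nK).
by rewrite card_Fp.
Qed.
End Formulas.

Theorem theorem1p3 (R : realType) :
  exists C1 C2 : R,
  forall (n p : nat) (p_pr : prime p)
    (mu : probability (borelType 'rV[padic_int p_pr]_n) R),
  (2 <= n)%N -> is_haar mu ->
  [/\ p = 2%N ->
        P_sqf mu (V_unit_const p_pr n) = 2 / 3 * (1 - (-1) ^+ n / 2 ^+ n),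
      p <> 2%N ->
        `| P_sqf mu (V_unit_const p_pr n)
           - (1 - (3 * p%:R - 1) / (p%:R * (p%:R + 1) ^+ 2)) |
        <= C1 * (n%:R / p%:R ^+ (n - 1)),
      `| P_max mu (V_unit_const p_pr n)
         - (1 - 1 / (p%:R ^+ 2 + p%:R + 1)) |
        <= C2 * (1 / p%:R ^+ (n + uphalf n)),
      0 < P_sqf mu (V_unit_const p_pr n) &
      0 < P_max mu (V_unit_const p_pr n)].
Proof.
(* The constants are those of [sqf_density_error] and [max_density_error]. *)
exists 2, 1 => n p p_pr mu n_ge2 mu_haar.
have cardF := card_Fp p_pr.
have max_err := max_density_error n_ge2 (P_max_formula n_ge2 mu_haar).
rewrite !cardF in max_err.
have p_ge2 : 2 <= p%:R :> R by rewrite ler_nat prime_gt1.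
have p_gt0 : 0 < p%:R :> R by rewrite ltr0n prime_gt0.
case: n n_ge2 mu mu_haar max_err => [//|[//|n]] n_ge2 mu mu_haar max_err.
have sqfE := P_sqf_formula mu_haar; split.
- move=> p2; rewrite sqfE count_sqf_ratio cardF p2 eqxx mulr0n addr0.
  by congr (_ / _ * _); ring.
- move=> /eqP p2; rewrite p2 mulr1n in sqfE.
  by have := sqf_density_error sqfE; rewrite !cardF subn1.
- by rewrite [X in _ <= X]mul1r.
- rewrite sqfE; apply: ltr_pwDl.
    by rewrite divr_gt0 // ?count_sqf_gt0 ?count_nz_gt0.
  rewrite mulrn_wge0 // divr_ge0 ?exprn_ge0 // sumr_ge0 // => a _.
  by apply: sumr_ge0.
(* Since p >= 2, the main term is at least 1 - 1/7 and the error at most 1/2. *)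
- have h1 : 1 / (p%:R ^+ 2 + p%:R + 1) <= 1 / 7 :> R.
    have p2 : 2 * 2 <= p%:R ^+ 2 :> R by rewrite expr2 ler_pM.
    rewrite ler_pdivrMr; last by rewrite !addr_gt0 ?exprn_gt0.
    rewrite mulrC mulrA mulr1 ler_pdivlMr //; lra.
  have h2 : 1 / p%:R ^+ (n.+2 + uphalf n.+2) <= 1 / 2 :> R.
    rewrite ler_pdivrMr ?exprn_gt0 // mulrC mulrA mulr1 ler_pdivlMr // mul1r.
    by rewrite (le_trans p_ge2) // ler_eXnr // (le_trans _ p_ge2) // ler1n.
  move: max_err; rewrite ler_norml => /andP[+ _].
  move: h1 h2; move: (1 / (_ + 1)) (1 / (_ ^+ _)) => u v; lra.
Qed.
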